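(* Let $\{S^n\}_{n\in\mathbb{N}}$ be an $\mathbb{R}^h$-valued process that is exponentially regular and exponentially nearly additive, and suppose $\sup_{n\in\mathbb{N}}|\Lambda^n|^{-1}\log\mathbb{E}[\exp(\langle\lambda,S^n\rangle)]<\infty$ for every $\lambda\in\mathbb{R}^h$. Then the limit $\widehat S=\lim_{n\to\infty}\mathbb{E}[S^n]/|\Lambda^n|$ exists in $\mathbb{R}^h$; for every $\lambda\in\mathbb{R}^h$ the limit $\varphi(\lambda)=\lim_{n\to\infty}|\Lambda^n|^{-1}\log\mathbb{E}[\exp(\langle\lambda,S^n\rangle)]$ exists in $\mathbb{R}$; the process $\{S^n/|\Lambda^n|\}_{n\in\mathbb{N}}$ satisfies the LDP with speed $|\Lambda^n|$ and good convex rate function $\varphi^*$; and $\varphi^*(x)=0$ if and only if $x=\widehat S$.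
   Context: Fix $d,h\in\mathbb{N}$, $|\Lambda^n|:=(2n)^d$, $\langle\cdot,\cdot\rangle$ and $\|\cdot\|$ the Euclidean inner product and norm on $\mathbb{R}^h$. Exponentially $r$-nearly additive (integer $r\ge0$): there exist $\mathbb{R}^h$-valued random variables $\{S^{n,z}\}_{n\in\mathbb{N},z\in\mathbb{Z}^d}$ such that for each $n$, $\{S^{n,z}\}_{z\in\mathbb{Z}^d}$ are independent copies of $S^n$, and for all $\varepsilon>0$, $C>0$ there is an integer $K>r$ with $P\bigl(\|S^{(2m+1)k}-\sum_{z\in\mathbb{Z}^d\cap[-m,m]^d}S^{k-r,z}\|>\varepsilon|\Lambda^{(2m+1)k}|\bigr)\le\exp(-C|\Lambda^{(2m+1)k}|)$ for all $k\ge K$, $m\in\mathbb{N}$. Exponentially nearly additive: exponentially $r$-nearly additive for some $r$. Exponentially regular: for each fixed $k\in\mathbb{N}$, letting $m_n$ be the unique integer with $(2m_n+1)k\le n<(2m_n+3)k$ (for $n\ge k$), for every $\varepsilon,C>0$ there is $N$ with $P(\|S^n-S^{(2m_n+1)k}\|>\varepsilon|\Lambda^n|)\le\exp(-C|\Lambda^n|)$ for all $n\ge N$. Fenchel–Legendre transform $\varphi^*(x)=\sup_{\lambda\in\mathbb{R}^h}\{\langle\lambda,x\rangle-\varphi(\lambda)\}$. LDP with speed $a_n$ and (good) rate function as standard. *)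

(* Defs.v *)
From HB Require Import structures.
From mathcomp Require Import all_boot all_order all_algebra.
From mathcomp Require Import all_classical all_reals all_analysis.
Set Implicit Arguments. Unset Strict Implicit. Unset Printing Implicit Defensive.
Import Order.TTheory GRing.Theory Num.Theory.
Import numFieldNormedType.Exports.
Local Open Scope classical_set_scope.
Local Open Scope ring_scope.

Section Defs.
Variable R : realType.

Definition inner (h : nat) (x y : 'rV[R]_h) : R := \sum_(i < h) x 0 i * y 0 i.
Definition enorm (h : nat) (x : 'rV[R]_h) : R := Num.sqrt (inner x x).

Definition Lam (d n : nat) : R := ((2 * n) ^ d)%:R.

Definition borelRV (h : nat) : set (set 'rV[R]_h) := <<s open >>.

Variables (dT : measure_display) (T : measurableType dT) (P : probability T R).

Definition rvec (h : nat) (X : T -> 'rV[R]_h) : Prop :=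
  forall A, borelRV A -> measurable (X @^-1` A).

Definition indep_family (h : nat) (I : eqType) (X : I -> T -> 'rV[R]_h) : Prop :=
  forall (J : seq I) (A : I -> set 'rV[R]_h), uniq J ->
    (forall i, i \in J -> borelRV (A i)) ->
    P (\bigcap_(i in [set` J]) (X i @^-1` A i)) = (\prod_(i <- J) P (X i @^-1` A i))%E.

Definition same_law (h : nat) (X Y : T -> 'rV[R]_h) : Prop :=
  forall A, borelRV A -> P (X @^-1` A) = P (Y @^-1` A).

(* The points of Z^d cap [-m,m]^d, each listed exactly once. *)
Definition box (d m : nat) : seq 'rV[int]_d :=
  [seq \row_(i < d) ((nat_of_ord (f i))%:Z - m%:Z)
    | f : {ffun 'I_d -> 'I_(2 * m + 1)%N} <- enum {ffun 'I_d -> 'I_(2 * m + 1)%N}].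

Definition exp_r_nearly_additive (d h r : nat) (S : nat -> T -> 'rV[R]_h) : Prop :=
  exists Sz : nat -> 'rV[int]_d -> T -> 'rV[R]_h,
    (forall n z, rvec (Sz n z)) /\
    (forall n, indep_family (Sz n)) /\
    (forall n z, same_law (Sz n z) (S n)) /\
    (forall eps C : R, 0 < eps -> 0 < C ->
      exists K : nat, (r < K)%N /\
        forall k m : nat, (K <= k)%N -> (1 <= m)%N ->
          (P [set w | (eps * Lam d ((2 * m + 1) * k) <
                     enorm (S ((2 * m + 1) * k)%N w - \sum_(z <- box d m) Sz (k - r)%N z w))%R]
          <= (expR (- C * Lam d ((2 * m + 1) * k))%R)%:E)%E).

Definition exp_nearly_additive (d h : nat) (S : nat -> T -> 'rV[R]_h) : Prop :=
  exists r : nat, exp_r_nearly_additive d r S.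

(* Exponentially regular; m ranges over the (unique) integer with
   (2m+1)k <= n < (2m+3)k. *)
Definition exp_regular (d h : nat) (S : nat -> T -> 'rV[R]_h) : Prop :=
  forall k : nat, (1 <= k)%N ->
    forall eps C : R, 0 < eps -> 0 < C ->
      exists N : nat, forall n m : nat, (N <= n)%N ->
        ((2 * m + 1) * k <= n < (2 * m + 3) * k)%N ->
        (P [set w | (eps * Lam d n < enorm (S n w - S ((2 * m + 1) * k)%N w))%R]
         <= (expR (- C * Lam d n)%R)%:E)%E.

Definition logmgf (h : nat) (X : T -> 'rV[R]_h) (l : 'rV[R]_h) : \bar R :=
  lne (\int[P]_w (expR (inner l (X w)))%:E)%E.

Definition expect_coord (h : nat) (X : T -> 'rV[R]_h) (i : 'I_h) : \bar R :=
  (\int[P]_w (X w 0 i)%:E)%E.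

(* Large deviation principle with speed a and rate function I
   (Dembo--Zeitouni form, over Borel sets). *)
Definition LDP (h : nat) (Y : nat -> T -> 'rV[R]_h) (a : nat -> R)
    (I : 'rV[R]_h -> \bar R) : Prop :=
  forall G, borelRV G ->
    (- ereal_inf (I @` interior G)
       <= limn_einf (fun n => (a n)^-1%:E * lne (P (Y n @^-1` G))))%E /\
    (limn_esup (fun n => (a n)^-1%:E * lne (P (Y n @^-1` G)))
       <= - ereal_inf (I @` closure G))%E.

End Defs.

Definition rate_function (R : realType) (h : nat) (I : 'rV[R]_h -> \bar R) : Prop :=
  (forall x, (0 <= I x)%E) /\ (forall a : R, closed [set x | (I x <= a%:E)%E]).

Definition good_rate_function (R : realType) (h : nat) (I : 'rV[R]_h -> \bar R) : Prop :=
  rate_function I /\ (forall a : R, compact [set x | (I x <= a%:E)%E]).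

Definition convex_efun (R : realType) (h : nat) (I : 'rV[R]_h -> \bar R) : Prop :=
  forall (x y : 'rV[R]_h) (t : R), 0 <= t <= 1 ->
    (I (t *: x + (1 - t) *: y)%R <= t%:E * I x + (1 - t)%:E * I y)%E.

Definition fenchel (R : realType) (h : nat) (phi : 'rV[R]_h -> R) (x : 'rV[R]_h) : \bar R :=
  ereal_sup (range (fun l : 'rV[R]_h => (inner l x - phi l)%:E)).

(* Main.v *)
Require Import Defs.
From HB Require Import structures.
From mathcomp Require Import all_boot all_order all_algebra.
From mathcomp Require Import all_classical all_reals all_analysis.
From mathcomp Require Import measurable_realfun ring lra zify.
Set Implicit Arguments. Unset Strict Implicit. Unset Printing Implicit Defensive.
Import Order.TTheory GRing.Theory Num.Theory.
Import numFieldNormedType.Exports.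
Local Open Scope classical_set_scope.
Local Open Scope ring_scope.

(** Only moment generating functions of the [S n] are ever estimated. For large [k], regularity and
    near additivity make [S n] superexponentially close to a sum [Z] of independent copies of
    [S (k - r)], so the normalized log-mgf of [S n] is within [eps * |l|] of the smooth convex function
    [Phi l = ln E exp <l, S (k - r)> / |Lambda^k|], uniformly on balls. Hence the limit [phi] exists.
    The error vanishes linearly at [l = 0], so [phi] is differentiable there, and its gradient at [0] is
    the limit of the means and the only zero of [phi^*].

    The upper bound is Chernoff's inequality applied to finitely many half-spaces covering a closed set.
    For the lower bound at [x], [Phi] being smooth, the regularized functional
    [Phi l - <l, x> + e0 / 2 * |l|^2] has an approximate minimiser [eta] with
    [y := x - e0 * eta] close to the gradient of [Phi] at [eta], and [<eta, y> - Phi eta] is at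
    most [phi^* x] up to a small error: tilting by [eta] gives Cramer's lower bound for [Z] near [y]. *)

(** * Inner product, l1 norm and measurability *)

(** An approximant is tilted instead, and this fixes the order of choices. The pair [j], [A] depends
    on the tolerances only. The volume defect [t] comes afterwards, so that [n] can go to infinity
    with the approximant held fixed, which leaves exactly the error [eps * norm1 l] for [phi]. The
    curvature constant of the approximant depends on [j], hence the threshold on [n] is chosen last.

    The free rate [C] of the exceptional events has two uses. To be negligible inside a moment
    generating function it must exceed [3 * B], where [B] bounds the normalized log-mgfs on a ball;
    to be negligible against the tilted probability it must exceed the cost [V + gm] of the lower
    bound. The inequality [a + 1 / a >= 2] with a free multiplier does the work of
    Cauchy-Schwarz. *)

Section Inner.
Variables (R : realType) (h : nat).
Implicit Types (x y l : 'rV[R]_h) (s : R).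

(** The estimates are coordinatewise, hence this norm; the Euclidean norm of the hypotheses is
    converted once, by [norm1_le_enorm]. *)
Definition norm1 x : R := \sum_(i < h) `|x 0 i|.
Definition dvec (i : 'I_h) : 'rV[R]_h := delta_mx 0 i.

Lemma innerDl l x y : inner (l + x) y = inner l y + inner x y.
Proof. by rewrite /inner -big_split; apply: eq_bigr => i _; rewrite mxE mulrDl. Qed.

Lemma innerC x y : inner x y = inner y x.
Proof. by apply: eq_bigr => i _; rewrite mulrC. Qed.

Lemma innerDr l x y : inner l (x + y) = inner l x + inner l y.
Proof. by rewrite innerC innerDl ![inner _ l]innerC. Qed.

Lemma innerZl s x y : inner (s *: x) y = s * inner x y.
Proof. by rewrite /inner mulr_sumr; apply: eq_bigr => i _; rewrite mxE mulrA. Qed.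

Lemma innerZr s x y : inner x (s *: y) = s * inner x y.
Proof. by rewrite innerC innerZl innerC. Qed.

Lemma innerNl x y : inner (- x) y = - inner x y.
Proof. by rewrite -scaleN1r innerZl mulN1r. Qed.

Lemma innerNr x y : inner x (- y) = - inner x y.
Proof. by rewrite innerC innerNl innerC. Qed.

Lemma inner0l y : inner 0 y = 0.
Proof. by rewrite -(scale0r 0) innerZl mul0r. Qed.

Lemma inner0r y : inner y 0 = 0.
Proof. by rewrite innerC inner0l. Qed.

Lemma inner_dvec i y : inner (dvec i) y = y 0 i.
Proof.
rewrite /inner (bigD1 i)//= mxE !eqxx mul1r big1 ?addr0// => j ji.
by rewrite mxE eqxx (negbTE ji) mul0r.
Qed.

Lemma inner_sumr (I : Type) (r : seq I) (F : I -> 'rV[R]_h) l :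
  inner l (\sum_(j <- r) F j) = \sum_(j <- r) inner l (F j).
Proof.
elim: r => [|j r IH]; first by rewrite !big_nil inner0r.
by rewrite !big_cons innerDr IH.
Qed.

Lemma norm1_ge0 x : 0 <= norm1 x. Proof. exact: sumr_ge0. Qed.

Lemma le_coord_norm1 x i : `|x 0 i| <= norm1 x.
Proof. by rewrite /norm1 (bigD1 i)//= lerDl sumr_ge0. Qed.

Lemma norm1D x y : norm1 (x + y) <= norm1 x + norm1 y.
Proof. by rewrite /norm1 -big_split; apply: ler_sum => i _; rewrite mxE ler_normD. Qed.

Lemma norm1Z s x : norm1 (s *: x) = `|s| * norm1 x.
Proof. by rewrite /norm1 mulr_sumr; apply: eq_bigr => i _; rewrite mxE normrM. Qed.

Lemma norm1N x : norm1 (- x) = norm1 x.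
Proof. by rewrite -scaleN1r norm1Z normrN1 mul1r. Qed.

Lemma norm1B x y : norm1 (x - y) = norm1 (y - x).
Proof. by rewrite -norm1N opprB. Qed.

Lemma norm1_dvec i : norm1 (dvec i) = 1.
Proof.
rewrite /norm1 (bigD1 i)//= mxE !eqxx normr1 big1 ?addr0// => j ji.
by rewrite mxE eqxx (negbTE ji) normr0.
Qed.

Lemma inner_le_norm1 l x : `|inner l x| <= norm1 l * norm1 x.
Proof.
rewrite (le_trans (ler_norm_sum _ _ _))// mulr_suml ler_sum// => i _.
by rewrite normrM ler_wpM2l// le_coord_norm1.
Qed.

Lemma inner_ge0 x : 0 <= inner x x.
Proof. by apply: sumr_ge0 => i _; rewrite -expr2 sqr_ge0. Qed.

Lemma coord_sqr_le_inner x i : x 0 i ^+ 2 <= inner x x.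
Proof.
rewrite /inner (bigD1 i)//= -expr2 lerDl sumr_ge0// => j _.
by rewrite -expr2 sqr_ge0.
Qed.

Lemma coord_le_enorm x i : `|x 0 i| <= enorm x.
Proof. by rewrite /enorm -sqrtr_sqr ler_sqrt ?inner_ge0// coord_sqr_le_inner. Qed.

Lemma norm1_le_enorm x : norm1 x <= h%:R * enorm x.
Proof.
apply: (@le_trans _ _ (\sum_(i < h) enorm x)).
  by apply: ler_sum => i _; exact: coord_le_enorm.
by rewrite sumr_const card_ord mulr_natl.
Qed.

End Inner.

(** * Measurability of random vectors *)

Section Measurability.
Context (R : realType) (h : nat) (dT : measure_display) (T : measurableType dT).
Implicit Types X Y : T -> 'rV[R]_h.

Definition measurable_coords X :=
  forall i, measurable_fun [set: T] (fun w => X w 0 i).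

Lemma continuous_borelRV (g : 'rV[R]_h -> R) (B : set R) :
  continuous g -> measurable B -> borelRV (g @^-1` B).
Proof.
move=> /continuousP cg mB.
have {mB} : (@RGenOpens.G R).-sigma.-measurable B.
  by rewrite -RGenOpens.measurableE; exact: mB.
apply: (@smallest_sub _ _ _ [set A | borelRV (g @^-1` A)]).
- split => /=.
  + by rewrite preimage_set0; exact: sigma_algebra0.
  + by move=> A bA; rewrite setTD preimage_setC -setTD; exact: sigma_algebraCD.
  + by move=> F bF; rewrite preimage_bigcup; exact: sigma_algebra_bigcup.
- move=> _ [a [b ->]] /=; apply: sub_sigma_algebra; apply: cg; exact: interval_open.
Qed.

Lemma inner_continuous (l : 'rV[R]_h) : continuous (inner l).
Proof.
rewrite /inner => x; elim: (index_enum _) => [|i s IH].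
  rewrite (_ : (fun _ => _) = cst 0); first exact: cst_continuous.
  by apply/funext => y; rewrite big_nil.
rewrite (_ : (fun _ => _) = (fun y : 'rV_h => l 0 i * y 0 i) \+
    (fun y : 'rV_h => \sum_(j <- s) l 0 j * y 0 j)); last first.
  by apply/funext => y; rewrite big_cons.
apply: continuousD => //; apply: continuousM; first exact: cst_continuous.
exact: coord_continuous.
Qed.

Lemma rvec_inner X l : rvec X -> measurable_fun [set: T] (fun w => inner l (X w)).
Proof.
move=> rX _ B mB; rewrite setTI.
by apply: (rX (inner l @^-1` B)); apply: continuous_borelRV => //; exact: inner_continuous.
Qed.

Lemma rvec_coords X : rvec X -> measurable_coords X.
Proof.
move=> rX i; have := @rvec_inner X (dvec R i) rX.
by under eq_fun do rewrite inner_dvec.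
Qed.

Lemma rvecZ (c : R) X : rvec X -> rvec (fun w => c *: X w).
Proof.
move=> rX A.
apply: (@smallest_sub _ _ _ [set A | measurable ((fun w => c *: X w) @^-1` A)]).
- split => /=.
  + by rewrite preimage_set0; exact: measurable0.
  + by move=> B bB; rewrite setTD preimage_setC; exact: measurableC.
  + by move=> F bF; rewrite preimage_bigcup; exact: bigcupT_measurable.
- move=> B oB /=.
  apply: (rX ((fun x : 'rV[R]_h => c *: x) @^-1` B)).
  apply: sub_sigma_algebra; move/continuousP : (@scaler_continuous _ ('rV[R]_h) c).
  exact.
Qed.

Lemma measurable_inner X l : measurable_coords X ->
  measurable_fun [set: T] (fun w => inner l (X w)).
Proof.
by move=> mX; apply: measurable_sum => i; apply: measurable_funM => //; exact: measurable_cst.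
Qed.

Lemma measurable_coordsB X Y : measurable_coords X -> measurable_coords Y ->
  measurable_coords (fun w => X w - Y w).
Proof.
move=> mX mY i; under eq_fun do rewrite !mxE; exact: measurable_funB.
Qed.

Lemma measurable_coords_sum (I : Type) (r : seq I) (X : I -> T -> 'rV[R]_h) :
  (forall j, measurable_coords (X j)) ->
  measurable_coords (fun w => \sum_(j <- r) X j w).
Proof.
by move=> mX i; under eq_fun do rewrite summxE; apply: measurable_sum => j; exact: mX.
Qed.

Lemma measurable_norm1 X : measurable_coords X ->
  measurable_fun [set: T] (fun w => norm1 (X w)).
Proof.
by move=> mX; apply: measurable_sum => i; apply: measurableT_comp => //; exact: mX.
Qed.

Lemma measurable_lt_fun (f g : T -> R) : measurable_fun setT f -> measurable_fun setT g ->
  measurable [set w | f w < g w].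
Proof.
move=> mf mg.
have := @measurable_realfun.measurable_fun_ltr _ _ _ _ _ _ mf mg measurableT [set true] I.
by rewrite setTI.
Qed.

Lemma measurable_le_fun (f g : T -> R) : measurable_fun setT f -> measurable_fun setT g ->
  measurable [set w | f w <= g w].
Proof.
move=> mf mg; rewrite (_ : [set w | f w <= g w] = ~` [set w | g w < f w]).
  by apply: measurableC; exact: measurable_lt_fun.
by apply/seteqP; split => w /=; rewrite leNgt => /negP.
Qed.

Lemma measurable_coord_box X (c : 'I_h -> R) (r : R) :
  measurable_coords X -> measurable [set w | forall i, `|X w 0 i - c i| <= r].
Proof.
move=> mX.
have -> : [set w | forall i, `|X w 0 i - c i| <= r] =
    \bigcap_(i in [set: 'I_h]) [set w | `|X w 0 i - c i| <= r].
  by apply/seteqP; split => w H i; [move=> _|]; exact: H.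
apply: fin_bigcap_measurable => // i _.
apply: measurable_le_fun; last exact: measurable_cst.
by apply: measurableT_comp => //; apply: measurable_funB; [exact: mX|exact: measurable_cst].
Qed.

Lemma measurable_enorm_gt (c : R) X : 0 <= c -> measurable_coords X ->
  measurable [set w | c < enorm (X w)].
Proof.
move=> c0 mX.
have -> : [set w | c < enorm (X w)] = [set w | c ^+ 2 < inner (X w) (X w)].
  apply/seteqP; split => w /=; rewrite /enorm.
    by move=> H; rewrite -(sqr_sqrtr (inner_ge0 _)) ltrXn2r// ?nnegrE ?sqrtr_ge0.
  by move=> H; rewrite -[c]ger0_norm// -sqrtr_sqr ltr_sqrt// (le_lt_trans _ H)// sqr_ge0.
apply: measurable_lt_fun; first exact: measurable_cst.
by apply: measurable_sum => i; exact: measurable_funM.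
Qed.

End Measurability.

(** * Independence and expectations of products *)

Section Independence.
Context (R : realType) (dT : measure_display) (T : measurableType dT) (P : probability T R).

Let mu : {sigma_finite_measure set (measurableTypeR R) -> \bar R} := @lebesgue_measure R.

(** Write [e w] as the Lebesgue measure of [[0, e w[] and apply Fubini-Tonelli. Integrals thereby
    reduce to the level sets [s < e w], which are the events that independence and equality of laws
    speak about. *)
Lemma layer_cake (H e : T -> R) :
  measurable_fun setT H -> measurable_fun setT e ->
  (forall w, 0 <= H w) -> (forall w, 0 <= e w) ->
  (\int[P]_w (H w * e w)%:E =
   \int[mu]_s \int[P]_w (H w * \1_(`[0, e w[) s)%:E)%E /\
  measurable_fun setT (fun s : measurableTypeR R => \int[P]_w (H w * \1_(`[0, e w[) s)%:E)%E.
Proof.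
move=> mH me H0 e0.
pose f (p : T * measurableTypeR R) : \bar R := (H p.1 * \1_(`[0, e p.1[) p.2)%:E.
have f0 p : (0 <= f p)%E by rewrite lee_fin mulr_ge0.
have mf : measurable_fun setT f.
  apply/measurable_EFinP; apply: measurable_funM; first exact: measurableT_comp.
  apply/measurable_indic => /=.
  pose g1 (p : T * measurableTypeR R) := (0 <= p.2)%R.
  pose g2 (p : T * measurableTypeR R) := (p.2 < e p.1)%R.
  rewrite [X in measurable X](_ : _ =
      g1 @^-1` [set true] `&` g2 @^-1` [set true]); last first.
    by apply/seteqP; split => p; rewrite in_itv/= => /andP.
  apply: measurableI.
  - have : measurable_fun setT g1 by exact: measurable_fun_ler.
    by move=> /(_ measurableT [set true]); rewrite setTI; exact.
  - have : measurable_fun setT g2.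
      by apply: measurable_fun_ltr => //; exact: measurableT_comp.
    by move=> /(_ measurableT [set true]); rewrite setTI; exact.
split; last by have := @measurable_fun_fubini_tonelli_G _ _ T (measurableTypeR R) R P f mf f0; exact.
transitivity (\int[P]_w \int[mu]_s f (w, s))%E; last exact: fubini_tonelli.
apply: eq_integral => w _; rewrite /f /=.
under eq_integral do rewrite EFinM.
rewrite ge0_integralZl_EFin//; last first.
  by apply/measurable_EFinP/measurable_indic.
rewrite integral_indic//= setIT lebesgue_measure_itv/= lte_fin EFinM.
case: ifPn => [_|]; first by rewrite oppr0 adde0.
by rewrite -leNgt => ew; rewrite (@le_anti _ _ (e w) 0)// ew e0.
Qed.

(** By [layer_cake] both sides are integrals over the level [s], so factorization on each set
    [t < e v] is enough. *)
Lemma ge0_expectation_mul (H e : T -> R) :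
  measurable_fun setT H -> measurable_fun setT e ->
  (forall w, 0 <= H w) -> (forall w, 0 <= e w) ->
  (forall t, \int[P]_w (H w * \1_([set v | t < e v]) w)%:E =
             (\int[P]_w (H w)%:E) * P [set v | (t < e v)%R])%E ->
  (\int[P]_w (H w * e w)%:E = (\int[P]_w (H w)%:E) * \int[P]_w (e w)%:E)%E.
Proof.
move=> mH me H0 e0 He.
have [-> _] := layer_cake mH me H0 e0.
have [E M] := layer_cake (measurable_cst (1 : R)) me (fun=> ler01) e0.
transitivity (\int[P]_w (H w)%:E * \int[P]_w (1 * e w)%:E)%E; last first.
  by under [in X in (_ * X)%E]eq_integral do rewrite mul1r.
rewrite E -ge0_integralZl//; last 2 first.
- by move=> s _; apply: integral_ge0 => w _; rewrite lee_fin mulr_ge0.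
- by apply: integral_ge0 => w _; rewrite lee_fin.
apply: eq_integral => s _.
have [s0|s0] := ltP s 0.
  have Z (K : T -> R) : (\int[P]_w (K w * \1_(`[0, e w[) s)%:E = 0)%E.
    apply: integral0_eq => w _; rewrite indicE memNset ?mulr0//=.
    by rewrite in_itv/= leNgt s0.
  by rewrite !Z mule0.
transitivity (\int[P]_w (H w * \1_([set v | s < e v]) w)%:E)%E.
  apply: eq_integral => w _; congr (_ * _)%:E; rewrite !indicE; congr ((nat_of_bool _)%:R).
  by apply/idP/idP; rewrite !inE/= in_itv/= s0.
rewrite He; congr (_ * _)%E; rewrite -(setIT [set v | s < e v]) -integral_indic//; last first.
  by apply: measurable_lt_fun => //; exact: measurable_cst.
apply: eq_integral => w _; congr (_%:E); rewrite mul1r !indicE; congr ((nat_of_bool _)%:R).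
by apply/idP/idP; rewrite !inE/= in_itv/= s0.
Qed.

Context (h : nat) (I : eqType) (X : I -> T -> 'rV[R]_h).
Hypothesis rX : forall i, rvec (X i).
Hypothesis iX : indep_family P X.

Let mind A i : borelRV A -> measurable_fun setT (\1_(X i @^-1` A) : T -> R).
Proof. by move=> bA; apply/measurable_indic; exact: rX. Qed.

Let bigcap_cons i (s : seq I) (F : I -> set T) :
  \bigcap_(j in [set` i :: s]) F j = F i `&` \bigcap_(j in [set` s]) F j.
Proof.
apply/seteqP; split => w /=.
  move=> H; split; first by apply: H; rewrite /= mem_head.
  by move=> j js; apply: H; rewrite /= in_cons js orbT.
by move=> [Fi H] j; rewrite /= in_cons => /predU1P[->//|]; exact: H.
Qed.

Let bigcap_measurable (s : seq I) (F : I -> set T) : (forall i, measurable (F i)) ->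
  measurable (\bigcap_(j in [set` s]) F j).
Proof.
move=> mF; elim: s => [|i s IH]; first by rewrite set_nil bigcap_set0.
by rewrite bigcap_cons; exact: measurableI.
Qed.

Lemma prod_indicE (s : seq I) (A : I -> set 'rV[R]_h) w :
  \prod_(i <- s) \1_(X i @^-1` A i) w = \1_(\bigcap_(i in [set` s]) (X i @^-1` A i)) w :> R.
Proof.
elim: s => [|i s IH]; first by rewrite big_nil set_nil bigcap_set0 indicE in_setT.
by rewrite big_cons IH bigcap_cons indicI.
Qed.

(** Induction on [s1]: the factor [g (X i)] is replaced by indicators of its level sets, so [i]
    migrates into the list of indicators. Hence the mixed form with [s2] and [A] general; [s1 =
    [::]] is the definition of independence. *)
Lemma indep_expectation_aux (g : 'rV[R]_h -> R) (s1 s2 : seq I) (A : I -> set 'rV[R]_h) :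
  (forall x, 0 <= g x) -> continuous g -> uniq (s1 ++ s2) ->
  (forall i, borelRV (A i)) ->
  (\int[P]_w ((\prod_(i <- s1) g (X i w)) * \prod_(i <- s2) \1_(X i @^-1` A i) w)%:E =
   (\prod_(i <- s1) \int[P]_w (g (X i w))%:E) * \prod_(i <- s2) P (X i @^-1` A i))%E.
Proof.
move=> g0 cg.
have mg i : measurable_fun setT (fun w => g (X i w)).
  by move=> _ B mB; rewrite setTI; exact: (@rX i (g @^-1` B) (continuous_borelRV cg mB)).
elim: s1 s2 A => [|i s1 IH] s2 A.
  rewrite cat0s => us2 bA; rewrite big_nil mul1e -iX//.
  under eq_integral do rewrite big_nil mul1r prod_indicE.
  rewrite integral_indic ?setIT//.
  by apply: bigcap_measurable => i; exact: rX.
move=> /= /andP[]; rewrite mem_cat negb_or => /andP[is1 is2] us bA.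
set H := fun w => (\prod_(i <- s1) g (X i w)) * \prod_(i <- s2) \1_(X i @^-1` A i) w.
have H0 w : 0 <= H w by rewrite mulr_ge0// prodr_ge0.
have mH : measurable_fun setT H.
  by apply: measurable_funM; apply: measurable_prod => j _ //; exact: mind.
have EH : (\int[P]_w (H w)%:E = (\prod_(i <- s1) \int[P]_w (g (X i w))%:E) *
    \prod_(i <- s2) P (X i @^-1` A i))%E by exact: IH.
transitivity (\int[P]_w (H w * g (X i w))%:E)%E.
  by apply: eq_integral => w _; rewrite big_cons /H; congr (_%:E); ring.
rewrite ge0_expectation_mul//; first by rewrite EH big_cons muleC muleA.
move=> t; rewrite EH.
pose A' j := if j == i then [set x | t < g x] else A j.
have A'i : A' i = [set x | t < g x] by rewrite /A' eqxx.
have A'j j : j \in s2 -> A' j = A j.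
  by move=> js2; rewrite /A'; case: eqP => // ji; rewrite -ji js2 in is2.
transitivity (\int[P]_w ((\prod_(i <- s1) g (X i w)) *
    \prod_(i <- i :: s2) \1_(X i @^-1` A' i) w)%:E)%E.
  apply: eq_integral => w _; rewrite /H big_cons A'i -!mulrA [X in _ = (_ * X)%:E]mulrC.
  by congr (_ * (_ * _))%:E; apply: eq_big_seq => j js2; rewrite A'j.
rewrite IH; last 2 first.
- by rewrite uniq_catC /= mem_cat negb_or is1 is2 uniq_catC.
- move=> j; rewrite /A'; case: ifP => // _.
  rewrite -[[set x | t < g x]]/(g @^-1` [set y | t < y]).
  by apply: continuous_borelRV => //; rewrite -set_itvoy.
rewrite big_cons A'i -muleA; congr (_ * _)%E; rewrite muleC; congr (_ * _)%E.
by apply: eq_big_seq => j js2; rewrite A'j.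
Qed.

Lemma indep_expectation_prod (g : 'rV[R]_h -> R) (s : seq I) :
  (forall x, 0 <= g x) -> continuous g -> uniq s ->
  (\int[P]_w (\prod_(i <- s) g (X i w))%:E = \prod_(i <- s) \int[P]_w (g (X i w))%:E)%E.
Proof.
move=> g0 cg us.
have := @indep_expectation_aux g s [::] (fun=> setT) g0 cg.
rewrite cats0 => /(_ us); rewrite big_nil mule1 => <-.
  by apply: eq_integral => w _; rewrite big_nil mulr1.
by move=> _; rewrite -setC0 -setTD; apply: sigma_algebraCD; exact: sigma_algebra0.
Qed.

End Independence.

Section SameLaw.
Context (R : realType) (dT : measure_display) (T : measurableType dT) (P : probability T R).

(** Layer cake with weight 1: each integral depends only on the probabilities of Borel level sets of
    [g]. *)
Lemma same_law_expectation (h : nat) (X Y : T -> 'rV[R]_h) (g : 'rV[R]_h -> R) :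
  (forall x, 0 <= g x) -> continuous g -> rvec X -> rvec Y -> same_law P X Y ->
  (\int[P]_w (g (X w))%:E = \int[P]_w (g (Y w))%:E)%E.
Proof.
move=> g0 cg rX rY XY.
have bg (s : R) : borelRV [set x | 0 <= s < g x].
  have [s0|s0] := leP 0 s; last first.
    by rewrite [X in borelRV X](_ : _ = set0)//; [exact: sigma_algebra0|apply/seteqP; split].
  rewrite -[X in borelRV X]/(g @^-1` [set y | s < y]).
  by apply: continuous_borelRV => //; rewrite -set_itvoy.
have mg Z : rvec Z -> measurable_fun [set: T] (fun w => g (Z w)).
  move=> rZ _ B mB; rewrite setTI.
  by apply: (rZ (g @^-1` B)); exact: continuous_borelRV.
have E Z : rvec Z -> (\int[P]_w (g (Z w))%:E =
    \int[lebesgue_measure]_s P (Z @^-1` [set x | (0 <= s < g x)%R]))%E.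
  move=> rZ.
  have [E _] := layer_cake P (measurable_cst (1 : R)) (mg Z rZ) (fun=> ler01) (fun w => g0 (Z w)).
  under eq_integral do rewrite -(mul1r (g _)).
  rewrite E; apply: eq_integral => s _.
  rewrite -[in RHS](setIT (_ @^-1` _)) -integral_indic//.
    apply: eq_integral => w _; congr (_%:E); rewrite mul1r !indicE; congr ((nat_of_bool _)%:R).
  by apply: rZ; exact: bg.
by rewrite !E//; apply: eq_integral => s _; apply: XY; exact: bg.
Qed.

End SameLaw.

(** * Moment generating functions *)

Section ExpBounds.
Variable R : realType.
Implicit Types u x s t : R.

(** Both signs come from tangent lines: [1 - u <= expR (- u)] gives [expR u * (1 - u) <= 1], and
    multiplying by [u >= 0] yields the quadratic remainder. *)
Lemma expR_quadratic u : expR u <= 1 + u + u ^+ 2 * expR `|u|.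
Proof.
have E1 : 1 + u <= expR u by exact: expR_ge1Dx.
have E2 : expR u * (1 - u) <= 1.
  have := expR_ge1Dx (- u); rewrite expRN => H.
  by rewrite -[X in _ <= X](mulfV (lt0r_neq0 (expR_gt0 u))) ler_wpM2l// expR_ge0.
have [u0|u0] := leP 0 u.
  rewrite ger0_norm//.
  have : u * (expR u * (1 - u)) <= u * 1 by rewrite ler_wpM2l.
  by lra.
rewrite ltr0_norm//.
have : 1 <= expR (- u) by rewrite -expR0 ler_expR; lra.
nra.
Qed.

(** The remainder is freed of [s] apart from the factor [s ^+ 2], so that it can be integrated:
    [x ^+ 2 <= 4 * expR |x|] gives the 4, and the product of two factors [expR |x|] gives the
    exponents [2 * x] and [- 2 * x]. *)
Lemma expR_scaled_quadratic s x : `|s| <= 1 ->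
  expR (s * x) <= 1 + s * x + 4 * s ^+ 2 * (expR (2 * x) + expR (- 2 * x)).
Proof.
move=> s1; apply: (le_trans (expR_quadratic _)); rewrite lerD2l exprMn.
have x0 := normr_ge0 x.
have -> : 4 * s ^+ 2 * (expR (2 * x) + expR (- 2 * x)) =
  s ^+ 2 * (4 * (expR (2 * x) + expR (- 2 * x))) by ring.
rewrite -mulrA ler_wpM2l ?sqr_ge0//.
have H1 : expR `|s * x| <= expR `|x|.
  by rewrite ler_expR normrM; nra.
have H2 : x ^+ 2 <= 4 * expR `|x|.
  have -> : `|x| = `|x| / 2 + `|x| / 2 by lra.
  rewrite expRD.
  have H : 1 + `|x| / 2 <= expR (`|x| / 2) by exact: expR_ge1Dx.
  by rewrite -(real_normK (num_real x)); nra.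
have H3 : expR `|x| * expR `|x| <= expR (2 * x) + expR (- 2 * x).
  rewrite -expRD.
  have P1 := expR_gt0 (2 * x). have P2 := expR_gt0 (- 2 * x).
  have [x0'|x0'] := leP 0 x.
    by rewrite ger0_norm// (_ : x + x = 2 * x); [lra|ring].
  by rewrite ltr0_norm// (_ : - x + - x = - 2 * x); [lra|ring].
have P3 := expR_gt0 `|s * x|; have P4 := expR_gt0 `|x|.
have := sqr_ge0 x.
by nra.
Qed.

Lemma norm_le_expR x : `|x| <= expR x + expR (- x).
Proof.
have := expR_ge1Dx x; have := expR_ge1Dx (- x); have := expR_gt0 x; have := expR_gt0 (- x).
by have [x0|x0] := leP 0 x; [rewrite ger0_norm|rewrite ltr0_norm]; lra.
Qed.

(** The coordinate of largest modulus dominates the inner product up to the factor [h * r]; its two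
    signs give two exponentials. *)
Lemma expR_inner_box (h : nat) (r : R) (l x : 'rV[R]_h) : (0 < h)%N -> 0 <= r ->
  (forall i, `|l 0 i| <= r) ->
  expR (inner l x) <= \sum_i (expR (h%:R * r * x 0 i) + expR (- (h%:R * r) * x 0 i)).
Proof.
case: h l x => // h l x _ r0 lr.
pose j := [arg max_(j > ord0) `|x 0 j|]%O.
have xj i : `|x 0 i| <= `|x 0 j|.
  by rewrite /j; case: arg_maxP => // k _; exact.
have H : inner l x <= h.+1%:R * r * `|x 0 j|.
  rewrite /inner -mulrA mulr_natl -[X in _ <= _ *+ X](card_ord h.+1) -sumr_const ler_sum// => i _.
  rewrite (le_trans (ler_norm _))// normrM.
  by apply: (le_trans (ler_wpM2r _ (lr i))) => //; rewrite ler_wpM2l.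
rewrite (bigD1 j)//= -[X in X <= _]addr0; apply: lerD.
  have P1 := expR_gt0 (h.+1%:R * r * x 0 j).
  have P2 := expR_gt0 (- (h.+1%:R * r) * x 0 j).
  have [x0|x0] := leP 0 (x 0 j); move: H.
    by rewrite ger0_norm// => H; rewrite (@le_trans _ _ (expR (h.+1%:R * r * x 0 j)))// ?ler_expR// lerDl ltW.
  rewrite ltr0_norm// mulrN -mulNr => H.
  by rewrite (@le_trans _ _ (expR (- (h.+1%:R * r) * x 0 j)))// ?ler_expR// lerDr ltW.
by apply: sumr_ge0 => i _; rewrite addr_ge0// expR_ge0.
Qed.

End ExpBounds.

Section Expectation.
Context (R : realType) (dT : measure_display) (T : measurableType dT) (P : probability T R).
Implicit Types (f g : T -> R).

Definition intble f := P.-integrable setT (EFin \o f).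
(** [Rintegral] takes [fine] of the integral, so an infinite integral would read as 0; this is why
    integrability accompanies the rules below. *)
Definition Ex f : R := Rintegral P setT f.

Lemma intble_measurable f : intble f -> measurable_fun setT f.
Proof. by move=> /measurable_int/measurable_EFinP. Qed.

Lemma intbleD f g : intble f -> intble g -> intble (fun w => f w + g w).
Proof. by move=> If Ig; exact: (integrableD measurableT If Ig). Qed.

Lemma intbleZ (c : R) f : intble f -> intble (fun w => c * f w).
Proof. by move=> If; exact: (integrableZl measurableT c If). Qed.

Lemma intble_cst (c : R) : intble (fun=> c).
Proof. by apply: finite_measure_integrable_cst. Qed.

Lemma intble_sum (I : Type) (r : seq I) (F : I -> T -> R) :
  (forall i, intble (F i)) -> intble (fun w => \sum_(i <- r) F i w).
Proof.
move=> IF; elim: r => [|i r IH].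
  by under eq_fun do rewrite big_nil; exact: intble_cst.
by under eq_fun do rewrite big_cons; exact: intbleD.
Qed.

Lemma intble_le f g : measurable_fun setT f -> (forall w, `|f w| <= g w) ->
  intble g -> intble f.
Proof.
move=> mf fg; apply: le_integrable => //; first exact/measurable_EFinP.
by move=> w _ /=; rewrite lee_fin (le_trans (fg w))// ler_norm.
Qed.

Lemma intble_indic (A : set T) : measurable A -> intble (\1_A).
Proof. by move=> mA; apply: intble_le (intble_cst 1) => // w; rewrite indicE; case: (_ \in _); rewrite ?normr1 ?normr0. Qed.

Lemma Ex_le f g : intble f -> intble g -> (forall w, f w <= g w) -> Ex f <= Ex g.
Proof. by move=> If Ig fg; apply: le_Rintegral. Qed.

Lemma ExD f g : intble f -> intble g -> Ex (fun w => f w + g w) = Ex f + Ex g.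
Proof. by move=> If Ig; exact: RintegralD. Qed.

Lemma ExZ (c : R) f : intble f -> Ex (fun w => c * f w) = c * Ex f.
Proof. by move=> If; exact: RintegralZl. Qed.

Lemma Ex_cst (c : R) : Ex (fun=> c) = c.
Proof.
by rewrite /Ex /Rintegral integral_cst// [X in (_ * X)%E]probability_setT mule1.
Qed.

Lemma Ex_indic (A : set T) : measurable A -> Ex (\1_A) = fine (P A).
Proof. by move=> mA; rewrite /Ex /Rintegral integral_indic// setIT. Qed.

Lemma Ex_sum (I : Type) (r : seq I) (F : I -> T -> R) :
  (forall i, intble (F i)) -> Ex (fun w => \sum_(i <- r) F i w) = \sum_(i <- r) Ex (F i).
Proof.
move=> IF; elim: r => [|i r IH].
  rewrite big_nil (_ : (fun _ => _) = fun=> 0) ?Ex_cst//.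
  by apply/funext => w; rewrite big_nil.
rewrite big_cons -IH -ExD//; last exact: intble_sum.
by congr Ex; apply/funext => w; rewrite big_cons.
Qed.

Lemma EFin_Ex f : intble f -> ((Ex f)%:E = \int[P]_w (f w)%:E)%E.
Proof. by move=> If; rewrite fineK//; exact: integrable_fin_num. Qed.

Lemma intble_ge0 f : measurable_fun setT f -> (forall w, 0 <= f w) ->
  (\int[P]_w (f w)%:E < +oo)%E -> intble f.
Proof.
move=> mf f0 fy; apply/integrableP; split; first exact/measurable_EFinP.
by under eq_integral do rewrite /= ger0_norm//.
Qed.

End Expectation.

Section Mgf.
Context (R : realType) (h : nat) (dT : measure_display) (T : measurableType dT).
Variable P : probability T R.
Implicit Types (X Y : T -> 'rV[R]_h) (l x y : 'rV[R]_h).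

Definition mgf X l : R := Ex P (fun w => expR (inner l (X w))).

Definition has_mgf X :=
  measurable_coords X /\ forall l, intble P (fun w => expR (inner l (X w))).

Lemma has_mgf_intble X : has_mgf X -> forall l, intble P (fun w => expR (inner l (X w))).
Proof. by case. Qed.

Lemma mgf0 X : mgf X 0 = 1.
Proof.
rewrite /mgf -[RHS](Ex_cst P); congr Ex; apply/funext => w.
by rewrite inner0l expR0.
Qed.

Lemma EFin_mgf X l : has_mgf X -> ((mgf X l)%:E = \int[P]_w (expR (inner l (X w)))%:E)%E.
Proof. by move=> HX; rewrite EFin_Ex//; exact: has_mgf_intble. Qed.

(** This is [a + 1 / a >= 2] at [a = t * expR (inner l (X w))], integrated. Below,
    [t = mgf X (- l) + 1] forces positivity and [t = (mgf X l)^-1] gives the product bound. *)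
Lemma mgf_amgm X l (t : R) : has_mgf X -> 0 < t -> 2 <= t * mgf X l + t^-1 * mgf X (- l).
Proof.
move=> HX t0.
have HI := has_mgf_intble HX.
rewrite -(Ex_cst P 2) /mgf -!ExZ// -ExD; [|exact: intbleZ..].
apply: Ex_le; [exact: intble_cst|by apply: intbleD; exact: intbleZ|].
move=> w; rewrite innerNl expRN -invfM.
set a := t * _.
have a0 : 0 < a by rewrite mulr_gt0// expR_gt0.
have aa : a * a^-1 = 1 by rewrite mulfV// gt_eqF.
have : 0 <= a^-1 * (a - 1) ^+ 2 by rewrite mulr_ge0 ?sqr_ge0// invr_ge0 ltW.
have -> : a^-1 * (a - 1) ^+ 2 = (a * a^-1) * a - 2 * (a * a^-1) + a^-1 by ring.
rewrite aa; lra.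
Qed.

Lemma mgf_ge0 X l : has_mgf X -> 0 <= mgf X l.
Proof.
move=> HX; rewrite -(Ex_cst P 0); apply: Ex_le; [exact: intble_cst|exact: has_mgf_intble|].
by move=> w; exact: expR_ge0.
Qed.

Lemma mgf_gt0 X l : has_mgf X -> 0 < mgf X l.
Proof.
move=> HX; rewrite lt_neqAle mgf_ge0// andbT; apply/eqP => m0.
have H0 := mgf_ge0 (- l) HX.
have t0 : 0 < mgf X (- l) + 1 by lra.
have := mgf_amgm l HX t0; rewrite -m0 mulr0 add0r => H.
have : (mgf X (- l) + 1)^-1 * (mgf X (- l) + 1) = 1 by rewrite mulVf// gt_eqF.
have : 0 < (mgf X (- l) + 1)^-1 by rewrite invr_gt0.
lra.
Qed.

(** Turns an upper bound at [- l] into a lower bound at [l], so upper bounds on log-mgfs suffice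
    everywhere. *)
Lemma mgf_mulN_ge1 X l : has_mgf X -> 1 <= mgf X l * mgf X (- l).
Proof.
move=> HX; have m0 := mgf_gt0 l HX.
have := @mgf_amgm X l (mgf X l)^-1 HX.
by rewrite invr_gt0 mulVf ?gt_eqF// invrK => /(_ m0); lra.
Qed.

(** Finitely many values control a whole ball: this makes the pointwise bound of the theorem locally
    uniform in [l]. *)
Lemma mgf_le_box X l (r : R) : has_mgf X -> (0 < h)%N -> (forall i, `|l 0 i| <= r) ->
  mgf X l <= \sum_i (mgf X ((h%:R * r) *: dvec R i) + mgf X (- (h%:R * r) *: dvec R i)).
Proof.
move=> HX h0 lr.
have r0 : 0 <= r by apply: le_trans (lr (Ordinal h0)).
have I2 i : intble P (fun w => expR (h%:R * r * X w 0 i) + expR (- (h%:R * r) * X w 0 i)).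
  by apply: intbleD; [have := HX.2 ((h%:R * r) *: dvec R i)|have := HX.2 (- (h%:R * r) *: dvec R i)];
    under eq_fun do rewrite innerZl inner_dvec.
apply: (@le_trans _ _ (Ex P (fun w => \sum_i (expR (h%:R * r * X w 0 i) + expR (- (h%:R * r) * X w 0 i))))).
  apply: Ex_le; [exact: has_mgf_intble|exact: intble_sum|] => w.
  exact: expR_inner_box.
rewrite Ex_sum//; apply: ler_sum => i _; rewrite /mgf -ExD; [|exact: has_mgf_intble..].
by apply: Ex_le => //; [apply: intbleD; exact: has_mgf_intble|move=> w; rewrite !innerZl inner_dvec].
Qed.

Lemma intble_coord X i : has_mgf X -> intble P (fun w => X w 0 i).
Proof.
move=> HX; apply: (@intble_le _ _ _ _ _ (fun w => expR (inner (dvec R i) (X w)) + expR (inner (- dvec R i) (X w)))).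
- exact: HX.1.
- by move=> w; rewrite innerNl inner_dvec; exact: norm_le_expR.
- by apply: intbleD; exact: has_mgf_intble.
Qed.

Definition mean X : 'rV[R]_h := \row_i Ex P (fun w => X w 0 i).

Lemma Ex_inner X l : has_mgf X ->
  intble P (fun w => inner l (X w)) /\ Ex P (fun w => inner l (X w)) = inner l (mean X).
Proof.
move=> HX.
have I1 i : intble P (fun w => l 0 i * X w 0 i) by apply: intbleZ; exact: intble_coord.
split; first exact: intble_sum.
rewrite Ex_sum//; apply: eq_bigr => i _; rewrite mxE ExZ//; exact: intble_coord.
Qed.

(** Integrate the tangent line of the exponential at the mean [c] of [inner l X]. *)
Lemma mgf_jensen X l : has_mgf X -> expR (inner l (mean X)) <= mgf X l.
Proof.
move=> HX; have [Ii <-] := Ex_inner l HX; set c := Ex _ _.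
have : Ex P (fun w => expR c * (1 - c) + expR c * inner l (X w)) <= mgf X l.
  apply: Ex_le; [|exact: has_mgf_intble|].
    by apply: intbleD; [exact: intble_cst|exact: intbleZ].
  move=> w.
  have := expR_ge1Dx (inner l (X w) - c); rewrite expRD expRN => H.
  have : expR c * (1 + (inner l (X w) - c)) <= expR c * (expR (inner l (X w)) / expR c).
    by rewrite ler_wpM2l// expR_ge0.
  by rewrite [X in _ <= X]mulrCA mulfV ?gt_eqF ?expR_gt0// mulr1; lra.
rewrite ExD; [|exact: intble_cst|exact: intbleZ].
by rewrite (Ex_cst P) ExZ// -/c; lra.
Qed.

(** The witness [c] is the integral of [X_i * expR (inner l X)], the partial derivative. A one-sided
    quadratic bound is all the smoothness that is used later, and it follows by integrating
    [expR_scaled_quadratic] against [expR (inner l X)]. *)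
Lemma mgf_quadratic X l i : has_mgf X -> exists c, forall s, `|s| <= 1 ->
  mgf X (l + s *: dvec R i) <= mgf X l + s * c +
    4 * s ^+ 2 * (mgf X (l + 2 *: dvec R i) + mgf X (l + (- 2) *: dvec R i)).
Proof.
move=> HX.
have HI := has_mgf_intble HX.
have Ic : intble P (fun w => X w 0 i * expR (inner l (X w))).
  apply: (@intble_le _ _ _ _ _ (fun w => expR (inner (l + dvec R i) (X w)) + expR (inner (l - dvec R i) (X w)))).
  - by apply: measurable_funM; [exact: HX.1|exact: intble_measurable (HI l)].
  - move=> w; rewrite !innerDl innerNl inner_dvec !expRD normrM (ger0_norm (expR_ge0 _)).
    by rewrite -mulrDr mulrC ler_wpM2l ?expR_ge0// norm_le_expR.
  - exact: intbleD.
exists (Ex P (fun w => X w 0 i * expR (inner l (X w)))) => s s1.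
rewrite /mgf -[X in _ + 4 * _ * X]ExD// -!ExZ//; last exact: intbleD.
rewrite -!ExD//; first last.
- exact: intbleZ.
- by apply: intbleZ; exact: intbleD.
- by apply: intbleD => //; exact: intbleZ.
apply: Ex_le => //.
  by apply: intbleD; [apply: intbleD => //; exact: intbleZ|apply: intbleZ; exact: intbleD].
move=> w; rewrite !innerDl !innerZl inner_dvec !expRD.
have := expR_scaled_quadratic (X w 0 i) s1.
have := expR_gt0 (inner l (X w)).
set a := expR (inner l _); set b := expR (s * _); set c := expR (2 * _); set d := expR (- 2 * _).
move=> a0 /(ler_wpM2l (ltW a0)).
by congr (_ <= _); ring.
Qed.

Lemma mgf_chernoff X l (c : R) : has_mgf X ->
  (P [set w | (c <= inner l (X w))%R] <= (expR (- c) * mgf X l)%:E)%E.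
Proof.
move=> HX; set A := [set w | _].
have mA : measurable A.
  by apply: measurable_le_fun; [exact: measurable_cst|exact: measurable_inner HX.1].
rewrite -(fineK (fin_num_measure P _ mA)) lee_fin -Ex_indic// /mgf -ExZ; last exact: has_mgf_intble.
apply: Ex_le; [exact: intble_indic|by apply: intbleZ; exact: has_mgf_intble|].
move=> w; rewrite -expRD indicE; case: (boolP (w \in A)) => wA; last exact: expR_ge0.
by rewrite inE in wA; rewrite -expR0 ler_expR addrC subr_ge0.
Qed.

(** Where [X] and [Y] are close, the exponents differ by at most [norm1 l * e]. On the exceptional
    set, [a <= (t * a^2 + 1 / t) / 2] with [a = expR (inner l X)] replaces Cauchy-Schwarz, with [t]
    left to be optimised. *)
Lemma mgf_compare X Y l (e p t : R) : has_mgf X -> has_mgf Y -> 0 < t ->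
  (P [set w | (e < norm1 (X w - Y w))%R] <= p%:E)%E ->
  mgf X l <= expR (norm1 l * e) * mgf Y l + (t * mgf X (2 *: l) + t^-1 * p) / 2.
Proof.
move=> HX HY t0; set A := [set w | _] => PA.
have mA : measurable A.
  apply: measurable_lt_fun; first exact: measurable_cst.
  by apply: measurable_norm1; apply: measurable_coordsB; [exact: HX.1|exact: HY.1].
have {PA} : Ex P (\1_A) <= p.
  by rewrite Ex_indic// -lee_fin fineK// fin_num_measure.
move=> /(ler_wpM2l (ltW (divr_gt0 ltr01 t0))); rewrite div1r => PA.
have HIX := has_mgf_intble HX; have HIY := has_mgf_intble HY; have HA := @intble_indic _ _ _ P _ mA.
have I2 : intble P (fun w => t * expR (inner (2 *: l) (X w)) + t^-1 * \1_A w).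
  by apply: intbleD; exact: intbleZ.
have I3 := intbleZ 2^-1 I2; have I4 := intbleZ (expR (norm1 l * e)) (HIY l).
suff H : mgf X l <= Ex P (fun w => expR (norm1 l * e) * expR (inner l (Y w)) +
      2^-1 * (t * expR (inner (2 *: l) (X w)) + t^-1 * \1_A w)).
  rewrite (le_trans H)// ExD// !ExZ// ExD ?ExZ//; [|exact: intbleZ..].
  by rewrite /mgf lerD2l mulrC ler_wpM2r// lerD2l.
apply: Ex_le => //; first exact: intbleD.
move=> w.
have XE : inner l (X w) = inner l (Y w) + inner l (X w - Y w) by rewrite -innerDr addrC subrK.
rewrite indicE; case: (boolP (w \in A)) => wA.
  rewrite -[X in X <= _]add0r; apply: lerD; first by rewrite mulr_ge0// expR_ge0.
  rewrite innerZl (_ : 2 * _ = inner l (X w) + inner l (X w)); last by ring.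
  rewrite expRD mulr1.
  set a := expR _.
  have a0 : 0 < a by exact: expR_gt0.
  have ti0 : 0 < t^-1 by rewrite invr_gt0.
  have tt : t * t^-1 = 1 by rewrite mulfV// gt_eqF.
  have : 0 <= t^-1 * (t * a - 1) ^+ 2 by rewrite mulr_ge0 ?sqr_ge0// ltW.
  have -> : t^-1 * (t * a - 1) ^+ 2 = (t * t^-1) * (t * (a * a)) - 2 * (t * t^-1) * a + t^-1 by ring.
  by rewrite tt; lra.
rewrite mulr0 addr0 -[X in X <= _]addr0; apply: lerD; last first.
  by rewrite !mulr_ge0// ?expR_ge0// ltW.
rewrite -expRD ler_expR XE addrC lerD2r.
have : norm1 (X w - Y w) <= e.
  by rewrite leNgt; apply/negP => H; move/negP: wA; apply; rewrite inE.
move=> H; apply: (le_trans (ler_norm _)); apply: (le_trans (inner_le_norm1 _ _)).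
by rewrite ler_wpM2l// norm1_ge0.
Qed.

(* The bound behind Cramer's lower bound: the tilted mass of [Z] outside the box around [b *: y]
   is estimated by Chernoff's inequality in the 2h coordinate directions, so that no tilted
   measure has to be constructed. *)
Lemma mgf_tilt X l y (b dl s : R) : has_mgf X -> 0 <= b -> 0 <= dl -> 0 < s ->
  mgf X l <= expR (b * (inner l y + norm1 l * dl)) *
      fine (P [set w | forall i, `|X w 0 i - b * y 0 i| <= b * dl]) +
    \sum_i (expR (- (s * b * (y 0 i + dl))) * mgf X (l + s *: dvec R i) +
            expR (- (s * b * (- y 0 i + dl))) * mgf X (l + (- s) *: dvec R i)).
Proof.
move=> HX b0 dl0 s0; set A := [set w | _].
have HI := has_mgf_intble HX.
have mA : measurable A := measurable_coord_box (fun i => b * y 0 i) (b * dl) HX.1.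
have HA := @intble_indic _ _ _ P _ mA.
pose F i w := expR (- (s * b * (y 0 i + dl))) * expR (inner (l + s *: dvec R i) (X w)) +
  expR (- (s * b * (- y 0 i + dl))) * expR (inner (l + (- s) *: dvec R i) (X w)).
have IF i : intble P (F i) by apply: intbleD; exact: intbleZ.
suff H : mgf X l <= Ex P (fun w => expR (b * (inner l y + norm1 l * dl)) * \1_A w + \sum_i F i w).
  rewrite (le_trans H)// ExD//; [|exact: intbleZ|exact: intble_sum].
  rewrite ExZ// Ex_indic// Ex_sum// lerD2l; apply: ler_sum => i _.
  by rewrite /F ExD ?ExZ//; exact: intbleZ.
apply: Ex_le => //.
  by apply: intbleD; [exact: intbleZ|exact: intble_sum].
have F0 i w : 0 <= F i w by rewrite addr_ge0// mulr_ge0// expR_ge0.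
move=> w; rewrite indicE; case: (boolP (w \in A)) => wA.
  rewrite mulr1 -[X in X <= _]addr0; apply: lerD; last exact: sumr_ge0.
  rewrite ler_expR; rewrite inE in wA.
  have -> : inner l (X w) = b * inner l y + inner l (X w - b *: y).
    by rewrite innerDr innerNr innerZr; ring.
  rewrite mulrDr lerD2l (le_trans (ler_norm _))// (le_trans (ler_norm_sum _ _ _))//.
  rewrite mulrCA mulr_suml ler_sum// => i _.
  by rewrite normrM !mxE ler_wpM2l//.
(* Off the box some coordinate deviates by more than [b * dl]; according to its sign, one of the two
   exponentials for that [i] alone dominates [expR (inner l (X w))]. *)
have {wA} [i Hi] : exists i, b * dl < `|X w 0 i - b * y 0 i|.
  move: wA; rewrite notin_setE => /existsNP[i /negP]; rewrite -ltNge => ?; by exists i.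
rewrite mulr0 add0r (bigD1 i)//= -[X in X <= _]addr0; apply: lerD; last exact: sumr_ge0.
rewrite /F !innerDl !innerZl inner_dvec -!expRD.
move: Hi; have [d0|d0] := leP 0 (X w 0 i - b * y 0 i).
  rewrite ger0_norm// => Hi.
  rewrite -[X in X <= _]addr0; apply: lerD; last exact: expR_ge0.
  by rewrite ler_expR; nra.
rewrite ltr0_norm// => Hi.
rewrite -[X in X <= _]add0r; apply: lerD; first exact: expR_ge0.
by rewrite ler_expR; nra.
Qed.

End Mgf.

Opaque mgf.

(** * Approximation by sums of independent copies *)

(** [2 * m + 1] is the largest odd number not exceeding [n %/ k]. *)
Lemma odd_block k n : (1 <= k)%N -> (k <= n)%N ->
  exists m, ((2 * m + 1) * k <= n < (2 * m + 3) * k)%N.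
Proof.
move=> k1 kn; exists ((n %/ k - 1) %/ 2)%N.
have q1 : (1 <= n %/ k)%N by rewrite divn_gt0.
have := leq_trunc_div n k; have := ltn_ceil n k1.
set q := (n %/ k)%N in q1 * => nq qn.
set m := ((q - 1) %/ 2)%N.
have m1 : (2 * m + 1 <= q)%N by rewrite /m; lia.
have m2 : (q.+1 <= 2 * m + 3)%N by rewrite /m; lia.
apply/andP; split.
  by apply: leq_trans qn; rewrite leq_mul2r m1 orbT.
by apply: (leq_trans nq); rewrite leq_mul2r m2 orbT.
Qed.

Section Volume.
Variables (R : realType) (d : nat).
Hypothesis d0 : (0 < d)%N.

Lemma Lam_ge1 n : (1 <= n)%N -> 1 <= Lam R d n.
Proof. by move=> n1; rewrite /Lam ler1n expn_gt0 muln_gt0 /= n1. Qed.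

Lemma Lam_gt0 n : (1 <= n)%N -> 0 < Lam R d n.
Proof. by move=> n1; apply: lt_le_trans (Lam_ge1 n1). Qed.

Lemma Lam_ge0 n : 0 <= Lam R d n. Proof. by rewrite /Lam. Qed.

Lemma le_Lam m n : (m <= n)%N -> Lam R d m <= Lam R d n.
Proof. by move=> mn; rewrite /Lam ler_nat leq_exp2r// leq_mul2l mn orbT. Qed.

Lemma Lam_ge_id n : n%:R <= Lam R d n.
Proof.
rewrite /Lam ler_nat; apply: (@leq_trans (2 * n)); first by rewrite leq_pmull.
case: n => [|n]; first by rewrite muln0.
by rewrite -[X in (X <= _)%N]expn1 leq_pexp2l// muln_gt0.
Qed.

Lemma Lam_unbounded (A : R) : exists N, forall n, (N <= n)%N -> A <= Lam R d n.
Proof.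
exists (Num.trunc A).+1 => n Nn; apply: le_trans (Lam_ge_id n).
by rewrite (le_trans (ltW (truncnS_gt A)))// ler_nat.
Qed.

Lemma LamM k n : Lam R d (k * n) = (k ^ d)%:R * Lam R d n.
Proof. by rewrite /Lam -natrM -expnMn mulnCA. Qed.

Lemma bernoulli_ineq (u : R) n : 0 <= u <= 1 -> 1 - n%:R * u <= (1 - u) ^+ n.
Proof.
move=> /andP[u0 u1]; elim: n => [|n IH]; first by rewrite mul0r subr0 expr0.
rewrite exprS -natr1.
have H : (1 - u) * (1 - n%:R * u) <= (1 - u) * (1 - u) ^+ n by rewrite ler_wpM2l// subr_ge0.
have : 0 <= n%:R * u ^+ 2 by rewrite mulr_ge0// sqr_ge0.
by nra.
Qed.

(** A block misses fewer than [2 * k] of [n], so the volume ratio is at least [(1 - 2 * k / n) ^ d],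
    and Bernoulli's inequality makes the loss at most [d * 2 * k / n]. *)
Lemma Lam_ratio k (t : R) : (1 <= k)%N -> 0 < t -> exists N, forall n m, (N <= n)%N ->
  ((2 * m + 1) * k <= n < (2 * m + 3) * k)%N ->
  (1 - t) * Lam R d n <= Lam R d ((2 * m + 1) * k).
Proof.
move=> k1 t0; exists (maxn (2 * k) (Num.trunc (t^-1 * (d%:R * (2 * k%:R)))).+1).+1 => n m.
rewrite gtn_max => /andP[kn] Bn /andP[mn nm].
have n0 : (0 : R) < n%:R by rewrite ltr0n (leq_ltn_trans _ kn).
pose u : R := 2 * k%:R / n%:R.
have u0 : 0 <= u by rewrite divr_ge0.
have u1 : u <= 1 by rewrite ler_pdivrMr// mul1r -natrM ler_nat ltnW.
have du : d%:R * u <= t.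
  rewrite /u mulrA ler_pdivrMr// -ler_pdivrMl//.
  by rewrite (le_trans (ltW (truncnS_gt _)))// ler_nat ltnW.
have H1 : 1 - t <= (1 - u) ^+ d.
  by apply: le_trans (bernoulli_ineq _ _); [lra|rewrite u0 u1].
have H2 : (1 - u) ^+ d * Lam R d n = (2 * (n%:R * (1 - u))) ^+ d.
  by rewrite /Lam natrX natrM -exprMn; congr (_ ^+ _); ring.
apply: (@le_trans _ _ ((1 - u) ^+ d * Lam R d n)); first by rewrite ler_wpM2r// Lam_ge0.
rewrite H2 /Lam natrX lerXn2r ?nnegrE//; first by rewrite !mulr_ge0// subr_ge0.
rewrite natrM ler_wpM2l//.
have -> : n%:R * (1 - u) = n%:R - 2 * k%:R by rewrite /u; field; rewrite gt_eqF.
rewrite lerBlDr -natrM -natrD ler_nat; lia.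
Qed.

End Volume.

Section Box.
Variable d : nat.

Lemma box_uniq m : uniq (box d m).
Proof.
rewrite /box map_inj_uniq ?enum_uniq// => f g fg.
apply/ffunP => i; apply/val_inj; move/rowP/(_ i): fg; rewrite !mxE => /addIr.
by case.
Qed.

Lemma size_box m : size (box d m) = ((2 * m + 1) ^ d)%N.
Proof. by rewrite /box size_map -cardE card_ffun !card_ord. Qed.

End Box.

Section Approximation.
Context (R : realType) (h : nat) (dT : measure_display) (T : measurableType dT).
Variables (P : probability T R) (S : nat -> T -> 'rV[R]_h).

(* [S n] is superexponentially close to a vector [Z] whose log-moment generating function is, up to
   the factor [b / A], that of a single [S j]: in the application [Z] is a sum of independent copies
   of [S j], and independence is used only through this identity. *)
Definition iid_approximable (a : nat -> R) := forall eps C : R, 0 < eps -> 0 < C ->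
  exists (j : nat) (A : R), [/\ (1 <= j)%N, a j <= A &
    forall t : R, 0 < t -> exists N, forall n, (N <= n)%N ->
      exists (b : R) (Z : T -> 'rV[R]_h),
      [/\ (1 - t) * a n <= b <= a n, has_mgf P Z,
         forall l, mgf P Z l = expR (b / A * ln (mgf P (S j) l)) &
         (P [set w | (eps * a n < norm1 (S n w - Z w))%R] <= (expR (- C * a n))%:E)%E]].

Lemma iid_sum_mgf (I : eqType) (X : I -> T -> 'rV[R]_h) (Y : T -> 'rV[R]_h) (s : seq I) :
  (forall i, rvec (X i)) -> rvec Y -> indep_family P X -> (forall i, same_law P (X i) Y) ->
  has_mgf P Y -> uniq s ->
  let Z := fun w => \sum_(i <- s) X i w in
  has_mgf P Z /\ forall l, mgf P Z l = mgf P Y l ^+ size s.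
Proof.
move=> rX rY iX XY HY us Z.
have E l : (\int[P]_w (expR (inner l (Z w)))%:E = (mgf P Y l ^+ size s)%:E)%E.
  have g0 (x : 'rV[R]_h) : 0 <= expR (inner l x) by exact: expR_ge0.
  have cg : continuous (fun x : 'rV[R]_h => expR (inner l x)).
    by move=> x; apply: continuous_comp; [exact: inner_continuous|exact: continuous_expR].
  transitivity (\int[P]_w (\prod_(i <- s) expR (inner l (X i w)))%:E)%E.
    by apply: eq_integral => w _; rewrite inner_sumr expR_sum.
  rewrite (indep_expectation_prod rX iX g0 cg us).
  rewrite (eq_bigr (fun=> (mgf P Y l)%:E)); last first.
    move=> i _; rewrite EFin_mgf//; by rewrite (same_law_expectation g0 cg (rX i) rY).
  elim: (s) => [|i s' IH]; first by rewrite big_nil expr0.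
  by rewrite big_cons IH -EFinM exprS.
have mZ : measurable_coords Z.
  by apply: measurable_coords_sum => i; exact: rvec_coords.
have HZ : has_mgf P Z.
  split => // l; apply: intble_ge0.
  - by apply: measurableT_comp => //; exact: measurable_inner.
  - by move=> w; exact: expR_ge0.
  - by rewrite E ltry.
by split => // l; apply: EFin_inj; rewrite EFin_mgf// E.
Qed.

(** Two steps lead from [S n] to [Z]: regularity replaces [n] by the odd multiple [(2 * m + 1) * K],
    then near additivity replaces that term by independent copies of [S (K - r)]. *)
Lemma nearly_additive_iid_approximable d : (0 < d)%N -> (0 < h)%N ->
  (forall n, rvec (S n)) -> (forall n, (1 <= n)%N -> has_mgf P (S n)) ->
  exp_regular P d S -> exp_nearly_additive P d S -> iid_approximable (Lam R d).
Proof.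
move=> d0 h0 rS HS regS [r [Sz [rSz [iSz [lSz nearS]]]]] eps C eps0 C0.
have hR0 : (0 : R) < h%:R by rewrite ltr0n.
(* The factor [h] passes from the Euclidean norm to [norm1]; the 2 shares [eps] between the two
   replacements. *)
have e0 : 0 < eps / (2 * h%:R) by rewrite divr_gt0// mulr_gt0.
(* Near additivity has rate in terms of the block volume, which is at least half of [Lam R d n];
   doubling the constant restores the rate [C + 1]. *)
have [K [rK nearK]] := nearS _ (2 * (C + 1)) e0 ltac:(lra).
have K1 : (1 <= K)%N by exact: leq_trans rK.
have j1 : (1 <= K - r)%N by rewrite subn_gt0.
exists (K - r)%N, (Lam R d K); split => //; first by apply: le_Lam => //; exact: leq_subr.
move=> t t0.
have [N1 ratio1] := Lam_ratio d0 K1 t0.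
have [N2 ratio2] := @Lam_ratio R d d0 K (1/2) K1 ltac:(lra).
have [N3 regK] := regS K K1 _ (C + 1) e0 ltac:(lra).
exists (maxn (maxn N1 N2) (maxn N3 (3 * K))) => n.
rewrite !geq_max => /andP[/andP[nN1 nN2] /andP[nN3 nK]].
have Kn : (K <= n)%N by lia.
have [m mn] := odd_block K1 Kn.
(* Near additivity is assumed for [m >= 1] only; [3 * K <= n] excludes [m = 0]. *)
have m1 : (1 <= m)%N.
  by case/andP: mn => _; case: (m) => // H; lia.
have n1 : (1 <= n)%N by lia.
have an1 : 1 <= Lam R d n by exact: Lam_ge1.
set k := ((2 * m + 1) * K)%N in mn ratio1 ratio2.
have {}ratio1 := ratio1 n m nN1 mn.
have {}ratio2 := ratio2 n m nN2 mn.
have {}regK := regK n m nN3 mn.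
have {}nearK := nearK K m (leqnn _) m1.
pose Z w := \sum_(z <- box d m) Sz (K - r)%N z w.
have [HZ mZ] := iid_sum_mgf (rSz (K - r)%N) (rS (K - r)%N) (iSz (K - r)%N) (lSz (K - r)%N)
  (HS _ j1) (box_uniq d m).
have kn : Lam R d k <= Lam R d n by apply: le_Lam => //; case/andP: mn.
exists (Lam R d k), Z; split => //; first by rewrite ratio1.
  (* The number [(2 * m + 1) ^ d] of copies is the volume ratio [b / A]. *)
  move=> l; rewrite mZ size_box LamM mulfK; last by rewrite gt_eqF// Lam_gt0.
  by rewrite expRM_natl lnK// posrE mgf_gt0//; exact: HS.
have mS i : measurable_coords (S i) by exact: rvec_coords.
have mZc : measurable_coords Z by exact: HZ.1.
set e := eps / (2 * h%:R) in e0 regK nearK.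
have mA : measurable [set w | e * Lam R d n < enorm (S n w - S k w)].
  by apply: measurable_enorm_gt; [rewrite mulr_ge0 ?Lam_ge0// ltW|exact: measurable_coordsB].
have mB : measurable [set w | e * Lam R d k < enorm (S k w - Z w)].
  by apply: measurable_enorm_gt; [rewrite mulr_ge0 ?Lam_ge0// ltW|exact: measurable_coordsB].
have mD : measurable [set w | eps * Lam R d n < norm1 (S n w - Z w)].
  apply: measurable_lt_fun; first exact: measurable_cst.
  by apply: measurable_norm1; exact: measurable_coordsB.
apply: (@le_trans _ _ (P ([set w | e * Lam R d n < enorm (S n w - S k w)] `|`
    [set w | e * Lam R d k < enorm (S k w - Z w)]))).
  apply: le_measure; rewrite ?inE//; first exact: measurableU.
  move=> w /=; apply: contraPP => /not_orP[/negP + /negP].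
  rewrite -!leNgt => H1 H2; apply/negP; rewrite -leNgt.
  have -> : S n w - Z w = (S n w - S k w) + (S k w - Z w) by rewrite addrA subrK.
  apply: (le_trans (norm1D _ _)).
  have H3 := le_trans (norm1_le_enorm (S n w - S k w)) (ler_wpM2l (ltW hR0) H1).
  have H4 := le_trans (norm1_le_enorm (S k w - Z w)) (ler_wpM2l (ltW hR0) H2).
  apply: (le_trans (lerD H3 H4)).
  have he : h%:R * e = eps / 2 by rewrite /e; field; rewrite gt_eqF.
  rewrite [X in X <= _](_ : _ = (h%:R * e) * (Lam R d n + Lam R d k)); last by ring.
  rewrite he; nra.
apply: (le_trans (measureU2 _ mA mB)).
apply: (@le_trans _ _ ((expR (- (C + 1) * Lam R d n))%:E + (expR (- (C + 1) * Lam R d n))%:E)).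
  apply: leeD => //; apply: (le_trans nearK); rewrite lee_fin ler_expR; nra.
rewrite -EFinD lee_fin.
(* The surplus 1 in the rate absorbs the two events: [2 <= expR (Lam R d n)] because the volume is
   at least 1. *)
have -> : - C * Lam R d n = - (C + 1) * Lam R d n + Lam R d n by ring.
rewrite expRD.
have := expR_ge1Dx (Lam R d n); have := expR_gt0 (- (C + 1) * Lam R d n).
nra.
Qed.

End Approximation.

(** * Limit of the normalized logarithmic moment generating functions *)

Section Sequences.
Variable R : realType.
Implicit Types (u : nat -> R) (p c e : R).

Definition tends u p := forall e, 0 < e -> exists N, forall n, (N <= n)%N -> `|u n - p| <= e.

(** A Cauchy criterion whose centre may change with [e]; the limit is the supremum of the eventual
    lower bounds. *)
Lemma tends_exists u :
  (forall e, 0 < e -> exists c, exists N, forall n, (N <= n)%N -> `|u n - c| <= e) ->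
  exists p, tends u p.
Proof.
move=> H.
pose E : set R := [set x | exists N, forall n, (N <= n)%N -> x <= u n].
have bnd c N e : (forall n, (N <= n)%N -> `|u n - c| <= e) ->
    E (c - e) /\ ubound E (c + e).
  move=> Hc; split.
    by exists N => n /Hc; rewrite ler_norml => /andP[]; lra.
  move=> x [M Hx].
  have := Hx (maxn N M) (leq_maxr _ _); have := Hc (maxn N M) (leq_maxl _ _).
  by rewrite ler_norml => /andP[]; lra.
exists (sup E) => e e0.
have [|c [N Hc]] := H (e / 2); first by rewrite divr_gt0.
have [E1 E2] := bnd _ _ _ Hc.
have Hs : has_sup E by split; [exists (c - e / 2)|exists (c + e / 2)].
have S1 : c - e / 2 <= sup E by exact: sup_upper_bound Hs _ E1.
have S2 : sup E <= c + e / 2 by apply: ge_sup => //; exact: Hs.1.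
exists N => n /Hc; rewrite !ler_norml => /andP[? ?]; apply/andP; split; lra.
Qed.

Lemma tends_window u p c e N : tends u p -> (forall n, (N <= n)%N -> `|u n - c| <= e) ->
  `|p - c| <= e.
Proof.
move=> up uc; apply/ler_addgt0Pr => g g0.
have [M HM] := up _ g0.
have := HM (maxn N M) (leq_maxr _ _); have := uc (maxn N M) (leq_maxl _ _).
by rewrite !ler_norml => /andP[? ?] /andP[? ?]; apply/andP; split; lra.
Qed.

Lemma tends_le u v p q N : tends u p -> tends v q ->
  (forall n, (N <= n)%N -> u n <= v n) -> p <= q.
Proof.
move=> up vq uv; apply/ler_addgt0Pr => g g0.
have [|M1 H1] := up (g / 2); first by rewrite divr_gt0.
have [|M2 H2] := vq (g / 2); first by rewrite divr_gt0.
pose n := maxn N (maxn M1 M2).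
have := H1 n; have := H2 n; have := uv n.
rewrite /n leq_maxl => /(_ isT) ? .
have -> : (M2 <= maxn N (maxn M1 M2))%N by rewrite !leq_max leqnn !orbT.
have -> : (M1 <= maxn N (maxn M1 M2))%N by rewrite !leq_max leqnn !orbT.
move=> /(_ isT); rewrite ler_norml => /andP[? ?].
move=> /(_ isT); rewrite ler_norml => /andP[? ?].
lra.
Qed.

Lemma tendsM u p c : tends u p -> tends (fun n => c * u n) (c * p).
Proof.
move=> up e e0.
have c1 : 0 < `|c| + 1 by rewrite ltr_wpDl.
have [|N HN] := up (e / (`|c| + 1)); first by rewrite divr_gt0.
exists N => n /HN H; rewrite -mulrBr normrM.
apply: (@le_trans _ _ ((`|c| + 1) * `|u n - p|)); first by rewrite ler_wpM2r// lerDl.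
by rewrite -ler_pdivlMl// mulrC.
Qed.

Lemma tends_sum (I : Type) (s : seq I) (u : I -> nat -> R) (p : I -> R) :
  (forall i, tends (u i) (p i)) -> tends (fun n => \sum_(i <- s) u i n) (\sum_(i <- s) p i).
Proof.
move=> up; elim: s => [|i s IH] e e0.
  by exists 0%N => n _; rewrite !big_nil subrr normr0 ltW.
have e2 : 0 < e / 2 by rewrite divr_gt0.
have [N1 H1] := up i _ e2; have [N2 H2] := IH _ e2.
exists (maxn N1 N2) => n; rewrite geq_max => /andP[/H1 + /H2].
rewrite !big_cons !ler_norml => /andP[? ?] /andP[? ?]; apply/andP; split; lra.
Qed.

Lemma cvg_tends u p : tends u p -> u @ \oo --> p.
Proof.
move=> up; apply/cvgrPdist_le => e e0.
have [N HN] := up _ e0; exists N => // n /= /HN; by rewrite distrC.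
Qed.

End Sequences.

(** Error budget: half of [t] pays for replacing [b] by [an], the other half for the additive
    constant [c], later [ln 2]. *)
Lemma normalized_window (R : realType) (an b t' t B eps nl F Phi c : R) :
  0 < an -> b <= an -> (1 - t') * an <= b -> `|Phi| <= B -> t' * B <= t / 2 ->
  c <= t / 2 * an -> F * an <= c + nl * (eps * an) + b * Phi ->
  b * Phi <= c + nl * (eps * an) + F * an -> `|F - Phi| <= eps * nl + t.
Proof.
move=> a0 ba tb PB tB ca U1 U2.
have G : `|(an - b) * Phi| <= t / 2 * an.
  rewrite normrM ger0_norm ?subr_ge0//.
  apply: (@le_trans _ _ ((t' * an) * B)); last first.
    by rewrite -mulrA (mulrC an) mulrA; apply: ler_wpM2r; [exact: ltW|].
  by apply: ler_pM; rewrite ?subr_ge0//; lra.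
move: G; rewrite ler_norml mulrBl => /andP[G1 G2].
rewrite ler_norml; apply/andP; split; rewrite -(ler_pM2r a0) ?mulNr !(mulrDl, mulNr).
  by move: G1 G2 U1 U2 ca; clear; lra.
by move: G1 G2 U1 U2 ca; clear; lra.
Qed.

(** * Uniform comparison with the approximants *)

Section LogMgf.
Context (R : realType) (h : nat) (dT : measure_display) (T : measurableType dT).
Variables (P : probability T R) (S : nat -> T -> 'rV[R]_h) (a : nat -> R).
Hypothesis h0 : (0 < h)%N.
Hypothesis a_ge1 : forall n, (1 <= n)%N -> 1 <= a n.
Hypothesis a_unbounded : forall A : R, exists N, forall n, (N <= n)%N -> A <= a n.
Hypothesis S_mgf : forall n, (1 <= n)%N -> has_mgf P (S n).
Hypothesis S_bound : forall l, exists M : R, forall n, (1 <= n)%N ->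
  ln (mgf P (S n) l) <= M * a n.
Hypothesis S_approx : iid_approximable P S a.

Local Ltac purge := clear - h0 a_ge1 a_unbounded S_mgf S_bound S_approx.

Definition lmgf n l : R := ln (mgf P (S n) l) / a n.

Let a_gt0 n : (1 <= n)%N -> 0 < a n.
Proof. by move=> n1; apply: lt_le_trans (a_ge1 n1). Qed.

Lemma ln_mgf_bounded (r : R) : exists2 B : R, 0 < B & forall n, (1 <= n)%N -> forall l,
  norm1 l <= r -> `|ln (mgf P (S n) l)| <= B * a n.
Proof.
have [M HM] := choice S_bound.
pose B0 := \sum_i (`|M ((h%:R * r) *: dvec R i)| + `|M (- (h%:R * r) *: dvec R i)|).
have B00 : 0 <= B0 by apply: sumr_ge0 => i _; rewrite addr_ge0.
have hR0 : (0 : R) < h%:R by rewrite ltr0n.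
(* The term [2 * h] absorbs the number of summands of [mgf_le_box], since
   [2 * h <= expR (2 * h * a n)]. *)
exists (B0 + 2 * h%:R); first by lra.
move=> n n1 l lr.
have an := a_ge1 n1; have an0 := a_gt0 n1; have HS := S_mgf n1.
suff U l' : norm1 l' <= r -> ln (mgf P (S n) l') <= (B0 + 2 * h%:R) * a n.
  rewrite ler_norml U// andbT lerNl.
  apply: le_trans (U (- l) _); last by rewrite norm1N.
  rewrite -subr_ge0 opprK addrC -lnM ?posrE ?mgf_gt0//.
  by rewrite ln_ge0// mgf_mulN_ge1.
move=> lr'; rewrite -ler_expR lnK ?posrE ?mgf_gt0//.
apply: (le_trans (mgf_le_box HS h0 (fun i => le_trans (le_coord_norm1 l' i) lr'))).
have Hb i (v : 'rV[R]_h) : v = (h%:R * r) *: dvec R i \/ v = - (h%:R * r) *: dvec R i ->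
    mgf P (S n) v <= expR (B0 * a n).
  move=> Hv; rewrite -[X in X <= _]lnK ?posrE ?mgf_gt0// ler_expR.
  apply: (le_trans (HM _ _ n1)); apply: ler_wpM2r; first exact: ltW.
  apply: (le_trans (ler_norm _)); rewrite /B0 (bigD1 i)//= -[X in X <= _]addr0.
  apply: lerD; last by apply: sumr_ge0 => ? _; rewrite addr_ge0.
  by case: Hv => ->; rewrite ?lerDl ?lerDr.
apply: (@le_trans _ _ (\sum_(i < h) (expR (B0 * a n) + expR (B0 * a n)))).
  by apply: ler_sum => i _; apply: lerD; apply: (Hb i); [left|right].
rewrite sumr_const card_ord -[(_ + _) *+ h]mulr_natr [X in _ <= expR X]mulrDl expRD.
have := expR_ge1Dx (2 * h%:R * a n); have := expR_gt0 (B0 * a n).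
set x := expR _; set y := expR _ => x0 Hy.
have : 2 * h%:R <= y by nra.
nra.
Qed.

(** With [t = expR (- 2 * B)] and exceptional probability [expR (- 3 * B)], both exceptional terms
    of [mgf_compare] are at most [expR (- B) <= mgf P Y l]. They at most double the main term, hence
    [ln 2]. *)
Lemma ln_mgf_compare (X Y : T -> 'rV[R]_h) l (e B : R) : 0 <= e -> 0 <= B ->
  has_mgf P X -> has_mgf P Y ->
  (P [set w | (e < norm1 (X w - Y w))%R] <= (expR (- 3 * B))%:E)%E ->
  ln (mgf P X (2 *: l)) <= B -> - B <= ln (mgf P Y l) ->
  ln (mgf P X l) <= ln 2 + norm1 l * e + ln (mgf P Y l).
Proof.
move=> e0 B0 HX HY PA HX2 HYl.
have X0 := mgf_gt0 l HX; have Y0 := mgf_gt0 l HY; have X20 := mgf_gt0 (2 *: l) HX.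
have := mgf_compare l HX HY (expR_gt0 (- 2 * B)) PA.
rewrite -expRN -expRD => H.
have HX2' : mgf P X (2 *: l) <= expR B by rewrite -[X in X <= _]lnK ?posrE// ler_expR.
have HYl' : expR (- B) <= mgf P Y l by rewrite -[X in _ <= X]lnK ?posrE// ler_expR.
have E1 : expR (- 2 * B) * mgf P X (2 *: l) <= expR (- B).
  apply: (le_trans (ler_wpM2l (expR_ge0 _) HX2')).
  by rewrite -expRD (_ : - 2 * B + B = - B)//; ring.
have E2 : expR (- (- 2 * B) + - 3 * B) = expR (- B) by congr expR; ring.
have ne : 1 <= expR (norm1 l * e) by rewrite -expR0 ler_expR mulr_ge0// norm1_ge0.
have H2 : mgf P X l <= 2 * expR (norm1 l * e) * mgf P Y l.
  rewrite (le_trans H)// E2 -!mulrA mulr_natl mulr2n lerD2l.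
  have E3 : (expR (- 2 * B) * mgf P X (2 *: l) + expR (- B)) / 2 <= expR (- B).
    by rewrite ler_pdivrMr// mulr_natr mulr2n lerD2r.
  apply: (le_trans E3); apply: (le_trans HYl').
  by rewrite -[X in X <= _]mul1r; apply: ler_wpM2r; [exact: ltW|exact: ne].
rewrite -[norm1 l * e]expRK -!lnM ?posrE ?expR_gt0// ?mulr_gt0 ?expR_gt0//.
have E0 := expR_gt0 (norm1 l * e).
have M0 : 0 < 2 * expR (norm1 l * e) by rewrite pmulr_rgt0.
by rewrite ler_ln ?posrE ?X0 ?(mulr_gt0 M0 Y0).
Qed.

(** The divisor is not [a j]: in the application [A] is the volume of the full block [K], while
    [j = K - r]. *)
Definition approximant (A : R) j l : R := ln (mgf P (S j) l) / A.

Lemma lmgf_approx (eps r C : R) : 0 < eps -> 0 <= r -> 0 < C ->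
  exists (j : nat) (A : R), [/\ (1 <= j)%N, 1 <= A &
    forall t : R, 0 < t -> exists N, forall n, (N <= n)%N ->
      (forall l, norm1 l <= r -> `|lmgf n l - approximant A j l| <= eps * norm1 l + t) /\
      exists (b : R) (Z : T -> 'rV[R]_h),
      [/\ (1 - t) * a n <= b <= a n, has_mgf P Z,
         forall l, mgf P Z l = expR (b * approximant A j l) &
         (P [set w | (eps * a n < norm1 (S n w - Z w))%R] <= (expR (- C * a n))%:E)%E]].
Proof.
move=> eps0 r0 C0.
(* The comparison at [l] involves [2 *: l], hence radius [2 * r]. The rate [C + 3 * B] below pays
   for that comparison and still leaves [C]. *)
have [B B0 HB] := ln_mgf_bounded (2 * r).
have [j [A [j1 aA HA]]] := @S_approx eps (C + 3 * B) eps0 ltac:(lra).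
have A1 : 1 <= A by exact: le_trans (a_ge1 j1) aA.
have A0 : 0 < A by lra.
exists j, A; split => // t t0.
(* Chosen so that [t' * B <= t / 2], while [t' <= 1] keeps [b] nonnegative. *)
pose t' := t / (2 * B + t).
have den : 0 < 2 * B + t by lra.
have t'0 : 0 < t' by rewrite divr_gt0.
have tB : t' * B <= t / 2.
  by rewrite /t' mulrAC ler_pdivrMr//; move: B0 t0; purge; nra.
have [N1 HN1] := HA (Num.min t t') ltac:(by rewrite lt_min t0).
have [N2 HN2] := a_unbounded (2 * ln 2 / t).
exists (maxn 1 (maxn N1 N2)) => n; rewrite !geq_max => /and3P[n1 nN1 nN2].
have {HN1} [b [Z [/andP[bn nb] HZ mZ PZ]]] := HN1 n nN1.
have {HN2} an2 := HN2 n nN2.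
have an0 := a_gt0 n1.
have mZ' l : mgf P Z l = expR (b * approximant A j l).
  by rewrite mZ /approximant; congr expR; rewrite mulrAC -mulrA.
have mn1 : Num.min t t' <= t by rewrite ge_min lexx.
have mn2 : Num.min t t' <= t' by rewrite ge_min lexx orbT.
have b1 : (1 - t) * a n <= b by apply: le_trans bn; apply: ler_wpM2r; [exact: ltW|rewrite lerD2l lerN2].
have b2 : (1 - t') * a n <= b by apply: le_trans bn; apply: ler_wpM2r; [exact: ltW|rewrite lerD2l lerN2].
have t'1 : t' <= 1 by rewrite /t' ler_pdivrMr//; lra.
have b0 : 0 <= b by apply: le_trans b2; apply: mulr_ge0; [rewrite subr_ge0|exact: ltW].
have Ba0 : 0 <= B * a n by apply: mulr_ge0; exact: ltW.
have Ca0 : 0 <= C * a n by apply: mulr_ge0; exact: ltW.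
split; last first.
  exists b, Z; split => //; first by rewrite b1.
  by apply: (le_trans PZ); rewrite lee_fin ler_expR; move: Ba0; purge; lra.
have bdA l : norm1 l <= 2 * r -> `|approximant A j l| <= B.
  move=> /(HB j j1) H; rewrite /approximant normrM normfV (gtr0_norm A0) ler_pdivrMr//.
  by apply: (le_trans H); apply: ler_wpM2l => //; exact: ltW.
have bdZ l : norm1 l <= 2 * r -> `|ln (mgf P Z l)| <= B * a n.
  move=> /bdA H; rewrite mZ' expRK normrM (ger0_norm b0) mulrC.
  by apply: ler_pM.
move=> l lr.
have l2 : norm1 l <= 2 * r by lra.
have l22 : norm1 (2 *: l) <= 2 * r by rewrite norm1Z ger0_norm//; lra.
have HSn := S_mgf n1.
have := bdZ _ l2; rewrite ler_norml => /andP[Z1 Z2].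
have := bdZ _ l22; rewrite ler_norml => /andP[Z3 Z4].
have := HB _ n1 _ l2; rewrite ler_norml => /andP[S1 S2].
have := HB _ n1 _ l22; rewrite ler_norml => /andP[S3 S4].
have e0 : 0 <= eps * a n by rewrite mulr_ge0// ltW.
have PZ1 : (P [set w | (eps * a n < norm1 (S n w - Z w))%R] <= (expR (- 3 * (B * a n)))%:E)%E.
  by apply: (le_trans PZ); rewrite lee_fin ler_expR; move: Ca0; purge; lra.
have PZ2 : (P [set w | (eps * a n < norm1 (Z w - S n w))%R] <= (expR (- 3 * (B * a n)))%:E)%E.
  by apply: le_trans PZ1; under eq_set do rewrite norm1B.
have U1 := ln_mgf_compare e0 Ba0 HSn HZ PZ1 S4 Z1.
have U2 := ln_mgf_compare e0 Ba0 HZ HSn PZ2 Z4 S1.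
have ZE : ln (mgf P Z l) = b * approximant A j l by rewrite mZ' expRK.
have an2' : ln 2 <= t / 2 * a n.
  by move: an2; rewrite ler_pdivrMr//; purge; lra.
have lE : ln (mgf P (S n) l) = lmgf n l * a n by rewrite /lmgf divfK// gt_eqF.
rewrite ZE lE in U1 U2.
exact: (normalized_window an0 nb b2 (bdA _ l2) tB an2' U1 U2).
Qed.

Lemma lmgf_limit l : exists p, tends (lmgf^~ l) p.
Proof.
apply: tends_exists => e e0.
have n1 : 0 < norm1 l + 1 by rewrite ltr_wpDl// norm1_ge0.
have [|j [A [_ _ H]]] := @lmgf_approx (e / (2 * (norm1 l + 1))) (norm1 l) 1 _ (norm1_ge0 l) ltr01.
  by rewrite divr_gt0// mulr_gt0.
have [|N HN] := H (e / 2); first by rewrite divr_gt0.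
exists (approximant A j l), N => n /HN[/(_ _ (lexx _)) H1 _].
apply: (le_trans H1).
have : e / (2 * (norm1 l + 1)) * norm1 l <= e / 2.
  rewrite invfM mulrA -mulrA ler_piMr//; first by rewrite divr_ge0// ltW.
  by rewrite mulrC ler_pdivrMr// mul1r lerDl.
lra.
Qed.

Definition log_mgf_approximable (phi : 'rV[R]_h -> R) := forall eps r C : R,
  0 < eps -> 0 <= r -> 0 < C ->
  exists (j : nat) (A : R), [/\ (1 <= j)%N, 1 <= A,
    forall l, norm1 l <= r -> `|phi l - approximant A j l| <= eps * norm1 l &
    forall t : R, 0 < t -> exists N, forall n, (N <= n)%N ->
      exists (b : R) (Z : T -> 'rV[R]_h),
      [/\ (1 - t) * a n <= b <= a n, has_mgf P Z,
         forall l, mgf P Z l = expR (b * approximant A j l) &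
         (P [set w | (eps * a n < norm1 (S n w - Z w))%R] <= (expR (- C * a n))%:E)%E]].

Lemma log_mgf_limit : exists phi : 'rV[R]_h -> R,
  (forall l, tends (lmgf^~ l) (phi l)) /\ log_mgf_approximable phi.
Proof.
have [phi Hphi] := choice lmgf_limit.
exists phi; split => // eps r C eps0 r0 C0.
have [j [A [j1 A1 H]]] := lmgf_approx eps0 r0 C0.
exists j, A; split => //.
  move=> l lr; apply/ler_addgt0Pr => e e0.
  have [N HN] := H e e0.
  by apply: (tends_window (Hphi l)) => n /HN[H1 _]; exact: H1.
by move=> t t0; have [N HN] := H t t0; exists N => n /HN[].
Qed.

End LogMgf.

(** * Limit of the means *)

Lemma ln_quadratic (R : realType) (m M s c k A : R) : 0 < m -> 0 < M -> 0 < A ->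
  M <= m + s * c + 4 * s ^+ 2 * k ->
  ln M / A <= ln m / A + s * (c / m / A) + s ^+ 2 * (4 * k / m / A).
Proof.
move=> m0 M0 A0 H.
have E : m + s * c + 4 * s ^+ 2 * k = m * (1 + (s * (c / m) + s ^+ 2 * (4 * k / m))).
  by field; rewrite gt_eqF.
have H2 : ln M <= ln m + (s * (c / m) + s ^+ 2 * (4 * k / m)).
  rewrite -ler_expR expRD !lnK ?posrE//; apply: (le_trans H); rewrite E ler_pM2l//.
  exact: expR_ge1Dx.
have -> : ln m / A + s * (c / m / A) + s ^+ 2 * (4 * k / m / A) =
  (ln m + (s * (c / m) + s ^+ 2 * (4 * k / m))) / A by ring.
by rewrite ler_pM2r// invr_gt0.
Qed.

Section Limits.
Context (R : realType) (h : nat) (dT : measure_display) (T : measurableType dT).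
Variables (P : probability T R) (S : nat -> T -> 'rV[R]_h) (a : nat -> R).
Variable phi : 'rV[R]_h -> R.
Hypothesis h0 : (0 < h)%N.
Hypothesis a_ge1 : forall n, (1 <= n)%N -> 1 <= a n.
Hypothesis a_unbounded : forall A : R, exists N, forall n, (N <= n)%N -> A <= a n.
Hypothesis S_mgf : forall n, (1 <= n)%N -> has_mgf P (S n).
Hypothesis phi_lim : forall l, tends ((lmgf P S a)^~ l) (phi l).
Hypothesis phi_approx : log_mgf_approximable P S a phi.

Local Ltac purge := clear - h0 a_ge1 a_unbounded S_mgf phi_lim phi_approx.

Let a_gt0 n : (1 <= n)%N -> 0 < a n.
Proof. by move=> n1; apply: lt_le_trans (a_ge1 n1). Qed.

Lemma phi0 : phi 0 = 0.
Proof.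
apply/eqP; rewrite -normr_le0 -[phi 0]subr0; apply: (@tends_window _ _ _ 0 _ 0%N (phi_lim 0)) => n _.
by rewrite /lmgf mgf0 ln1 mul0r subrr normr0.
Qed.

(** [K] is uniform over the ball: [D] bounds the mgf on radius [r + 2], which contains the shifts by
    2 in [mgf_quadratic], and also bounds the inverse, since [1 / mgf l <= mgf (- l)]. *)
Lemma approximant_quadratic A j (r : R) : (1 <= j)%N -> 1 <= A -> exists K, 0 <= K /\
  forall l, norm1 l <= r -> forall i, exists c, forall s, `|s| <= 1 ->
  approximant P S A j (l + s *: dvec R i) <= approximant P S A j l + s * c + s ^+ 2 * K.
Proof.
move=> j1 A1; have A0 : 0 < A by apply: lt_le_trans A1.
have HX := S_mgf j1.
pose r' := r + 2.
pose D := \sum_i (mgf P (S j) ((h%:R * r') *: dvec R i) + mgf P (S j) (- (h%:R * r') *: dvec R i)).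
have mD l : norm1 l <= r' -> mgf P (S j) l <= D.
  by move=> lr; apply: mgf_le_box => // i; apply: le_trans (le_coord_norm1 l i) lr.
have D0 : 0 <= D.
  by apply: sumr_ge0 => i _; apply: addr_ge0; exact: mgf_ge0.
exists (4 * (D + D) * D / A); split.
  by apply: divr_ge0; [|exact: ltW]; apply: mulr_ge0 => //; apply: mulr_ge0 => //; exact: addr_ge0.
move=> l lr i; have m0 := mgf_gt0 l HX.
have [c Hc] := mgf_quadratic l i HX.
exists (c / mgf P (S j) l / A) => s s1.
apply: (le_trans (ln_quadratic m0 (mgf_gt0 _ HX) A0 (Hc s s1))).
rewrite /approximant lerD2l; apply: ler_wpM2l; first exact: sqr_ge0.
apply: ler_wpM2r; first by rewrite invr_ge0 ltW.
have Dm : (mgf P (S j) l)^-1 <= D.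
  rewrite -[X in X <= _]mul1r ler_pdivrMr// (le_trans (mgf_mulN_ge1 l HX))// mulrC.
  by apply: ler_wpM2r; [exact: ltW|apply: mD; rewrite norm1N /r'; lra].
have k (s' : R) : `|s'| = 2 -> mgf P (S j) (l + s' *: dvec R i) <= D.
  move=> s'2; apply: mD; apply: (le_trans (norm1D _ _)).
  by rewrite norm1Z norm1_dvec s'2 mulr1 /r' lerD2r.
have k1 := k 2 (ger0_norm (ler0n _ 2)).
have k2 := k (- 2) ltac:(by rewrite normrN ger0_norm).
have k3 := mgf_ge0 (l + 2 *: dvec R i) HX; have k4 := mgf_ge0 (l + (- 2) *: dvec R i) HX.
have k12 := lerD k1 k2; have k34 := addr_ge0 k3 k4.
apply: ler_pM.
- by apply: mulr_ge0.
- by rewrite invr_ge0 ltW.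
- by rewrite ler_pM2l.
- exact: Dm.
Qed.

Definition nmean n i : R := mean P (S n) 0 i / a n.

Lemma nmean_jensen (l : 'rV[R]_h) n : (1 <= n)%N -> \sum_i l 0 i * nmean n i <= lmgf P S a n l.
Proof.
move=> n1; have HX := S_mgf n1; have an := a_gt0 n1.
rewrite /lmgf ler_pdivlMr//.
have -> : (\sum_i l 0 i * nmean n i) * a n = inner l (mean P (S n)).
  rewrite mulr_suml; apply: eq_bigr => i _; rewrite /nmean.
  by rewrite -mulrA divfK// gt_eqF.
rewrite -ler_expR lnK ?posrE ?mgf_gt0//; exact: mgf_jensen.
Qed.

(* At the origin the error [eps * norm1 l] is of first order, so [phi] inherits there the
   differentiability of the approximants. *)
Lemma mean_window i (e : R) : 0 < e -> exists c,
  (exists N, forall n, (N <= n)%N -> `|nmean n i - c| <= 3 * e) /\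
  (forall x, (forall l, inner l x <= phi l) -> `|x 0 i - c| <= 3 * e).
Proof.
move=> e0.
have [j [A [j1 A1 HA _]]] := phi_approx e0 ler01 ltr01.
have [K [K0 HK']] := @approximant_quadratic A j 0 j1 A1.
have [|c HK] := HK' 0 _ i; first by rewrite /norm1 big1// => k _; rewrite mxE normr0.
have U s : `|s| <= 1 -> phi (s *: dvec R i) <= s * c + s ^+ 2 * K + e * `|s|.
  move=> s1; have := HA (s *: dvec R i).
  rewrite norm1Z norm1_dvec mulr1 => /(_ s1); rewrite ler_norml => /andP[_].
  have := HK s s1; rewrite add0r [approximant _ _ _ _ 0]/approximant mgf0 ln1 mul0r add0r.
  by purge; lra.
(* Makes [s * K <= e]. In slope, the curvature costs [e], the approximation another [e], and the
   tolerance [s * e] in the two limits below a third. *)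
pose s := Num.min 1 (e / (K + 1)).
have K1 : 0 < K + 1 by move: K0; purge; lra.
have s0 : 0 < s by rewrite lt_min ltr01 divr_gt0.
have s1 : `|s| <= 1 by rewrite gtr0_norm// ge_min lexx.
have sK : s * K <= e.
  have : s <= e / (K + 1) by rewrite ge_min lexx orbT.
  rewrite ler_pdivlMr//; move: s0; purge; lra.
have Up : phi (s *: dvec R i) <= s * (c + 2 * e).
  apply: (le_trans (U s s1)); rewrite (gtr0_norm s0) expr2.
  by move: s0 sK; purge; nra.
have Um : phi ((- s) *: dvec R i) <= - s * (c - 2 * e).
  have := U (- s); rewrite normrN => /(_ s1) H; apply: (le_trans H).
  rewrite (gtr0_norm s0) sqrrN expr2.
  by move: s0 sK; purge; nra.
exists c; split; last first.
  move=> x Hx.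
  have := le_trans (Hx _) Up; have := le_trans (Hx _) Um.
  rewrite !innerZl inner_dvec !mulNr lerN2 !ler_pM2l// ler_norml => ? ?.
  by apply/andP; split; lra.
have se : 0 < s * e by rewrite mulr_gt0.
have [N1 H1] := phi_lim (s *: dvec R i) se.
have [N2 H2] := phi_lim ((- s) *: dvec R i) se.
exists (maxn 1 (maxn N1 N2)) => n; rewrite !geq_max => /and3P[n1 /H1 + /H2].
rewrite !ler_norml => /andP[_ F1] /andP[_ F2].
have J t : t * nmean n i <= lmgf P S a n (t *: dvec R i).
  apply: le_trans (nmean_jensen _ n1); rewrite (bigD1 i)//= !mxE !eqxx mulr1 big1 ?addr0//.
  by move=> k ki; rewrite !mxE eqxx (negbTE ki) mulr0 mul0r.
have J1 := J s; have J2 := J (- s).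
have : s * nmean n i <= s * (c + 3 * e).
  by move: Up J1 F1; purge; lra.
have : s * (c - 3 * e) <= s * nmean n i.
  by move: Um J2 F2; purge; lra.
by rewrite !(ler_pM2l s0) => G1 G2; apply/andP; split; move: G1 G2; purge; lra.
Qed.

(** The normalized means and every subgradient of [phi] at 0 lie in the same small windows, so such
    a subgradient can only be the limit of the means; that limit is one because Jensen's inequality
    passes to the limit. *)
Lemma mean_limit : exists Shat : 'rV[R]_h,
  (forall i, tends (nmean^~ i) (Shat 0 i)) /\
  (forall x, (forall l, inner l x <= phi l) <-> x = Shat).
Proof.
have H i : exists p, tends (nmean^~ i) p.
  apply: tends_exists => e e0.
  have [|c [Hc _]] := @mean_window i (e / 3); first by rewrite divr_gt0.
  by exists c; rewrite mulrC divfK in Hc.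
have [p Hp] := choice H.
exists (\row_i p i).
have Hs i : tends (nmean^~ i) ((\row_i p i) 0 i) by rewrite mxE.
split => // x; split.
  move=> Hx; apply/rowP => i; rewrite mxE; apply/eqP; rewrite -subr_eq0 -normr_le0.
  apply/ler_addgt0Pr => e e0.
  have [|c [[N Hc] Hc']] := @mean_window i (e / 6); first by rewrite divr_gt0.
  have := Hc' x Hx; have := tends_window (Hp i) Hc.
  rewrite !ler_norml => /andP[? ?] /andP[? ?]; apply/andP; split; lra.
move=> -> l; apply: (tends_le (N := 1) _ (phi_lim l)); last first.
  by move=> n n1; exact: nmean_jensen n1.
by apply: tends_sum => i; apply: tendsM.
Qed.

End Limits.

(** * Tilting *)

(* [Phi l - <l, x> + e0 / 2 * |l|^2] has approximate minimisers [eta] even when [x] lies on the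
   boundary of the domain of the Fenchel transform of [Phi]; up to [dl], the nearby point
   [x - e0 * eta] is then the gradient of [Phi] at [eta]. *)
Lemma exposed_point (R : realType) (h : nat) (Phi : 'rV[R]_h -> R) (x : 'rV[R]_h)
    (V K r e0 dl : R) :
  Phi 0 = 0 -> 0 < e0 -> 0 < dl -> 0 <= K -> 0 <= V ->
  1 + h%:R * (2 * (V + 1) / e0 + 1) <= r ->
  (forall l, norm1 l <= r -> inner l x - V - 1 / 2 <= Phi l) ->
  (forall l, norm1 l <= r -> forall i, exists c, forall s, `|s| <= 1 ->
     Phi (l + s *: dvec R i) <= Phi l + s * c + s ^+ 2 * K) ->
  exists (eta : 'rV[R]_h) (s : R),
    [/\ norm1 eta <= r, 0 < s, e0 * inner eta eta <= 2 * (V + 1) &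
      forall i, Phi (eta + s *: dvec R i) <=
                  Phi eta + s * (x - e0 *: eta) 0 i + 3 / 4 * (s * dl) /\
                Phi (eta + (- s) *: dvec R i) <=
                  Phi eta - s * (x - e0 *: eta) 0 i + 3 / 4 * (s * dl)].
Proof.
move=> Phi0 e00 dl0 K0 V0 rb low quad.
pose g l := Phi l - inner l x + e0 / 2 * inner l l.
pose K' := K + e0 / 2.
have K'0 : 0 < K' by rewrite /K'; lra.
(* With [s * K' <= dl / 4] and [tau <= s * dl / 4], approximate minimality at steps [s] and [- s]
   puts the slope [c i] within [dl / 2] of coordinate [i] of [x - e0 *: eta]; curvature adds
   [dl / 4], whence the factor 3/4. *)
pose s := Num.min 1 (dl / (4 * K')).
have s0 : 0 < s by rewrite lt_min ltr01 divr_gt0// mulr_gt0.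
have s1 : s <= 1 by rewrite ge_min lexx.
have sK : s * K' <= dl / 4.
  have : s <= dl / (4 * K') by rewrite ge_min lexx orbT.
  by rewrite ler_pdivlMr ?mulr_gt0//; lra.
pose tau := Num.min (1 / 2) (s * dl / 4).
have tau0 : 0 < tau by rewrite lt_min divr_gt0//= divr_gt0// mulr_gt0.
have tau1 : tau <= 1 / 2 by rewrite ge_min lexx.
have tau2 : tau <= s * dl / 4 by rewrite ge_min lexx orbT.
pose E : set R := [set z | exists l, norm1 l <= r /\ z = g l].
have hn : 0 <= h%:R * (2 * (V + 1) / e0 + 1).
  by rewrite mulr_ge0// addr_ge0// divr_ge0 ?mulr_ge0 ?ltW//; lra.
have r1 : 1 <= r by lra.
have n0 : norm1 (0 : 'rV[R]_h) <= r.
  by rewrite (le_trans _ (le_trans ler01 r1))// /norm1 big1// => k _; rewrite mxE normr0.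
have g0 : g 0 = 0 by rewrite /g Phi0 !inner0l mulr0; lra.
have hE : has_inf E.
  split; first by exists (g 0), 0.
  exists (- V - 1 / 2) => _ [l [lr ->]]; rewrite /g.
  have := low l lr; have : 0 <= e0 / 2 * inner l l by rewrite mulr_ge0 ?inner_ge0// divr_ge0// ltW.
  lra.
have [_ [eta [etar ->]] geta] := inf_adherent tau0 hE.
have min l : norm1 l <= r -> g eta <= g l + tau.
  move=> lr; rewrite (le_trans (ltW geta))// lerD2r.
  by apply: (inf_lbound hE.2); exists l.
(* Comparison with [l = 0], where [g] vanishes; [tau <= 1 / 2] and the slack 1/2 in [low] make up
   the 1. *)
have q : e0 * inner eta eta <= 2 * (V + 1).
  have := min 0 n0; rewrite g0 /g; have := low eta etar; lra.
(* By [|z| <= z^2 + 1] in each coordinate, the lower bound on [r] leaves a margin 1: unit steps from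
   [eta] stay in the ball where minimality is known. *)
have etar1 : norm1 eta + 1 <= r.
  apply: le_trans rb; rewrite addrC lerD2l /norm1 mulr_natl.
  rewrite -[X in _ <= _ *+ X](card_ord h) -sumr_const; apply: ler_sum => i _.
  have H : eta 0 i ^+ 2 <= 2 * (V + 1) / e0.
    rewrite ler_pdivlMr// mulrC; apply: le_trans q.
    by apply: ler_wpM2l; [exact: ltW|exact: coord_sqr_le_inner].
  apply: (le_trans _ (lerD H (lexx 1))).
  by rewrite -(real_normK (num_real (eta 0 i))); have := normr_ge0 (eta 0 i); nra.
have [c Hc] := choice (quad eta etar).
have step i u : `|u| <= 1 -> - tau <= u * (c i - (x - e0 *: eta) 0 i) + u ^+ 2 * K'.
  move=> u1.
  have lr : norm1 (eta + u *: dvec R i) <= r.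
    apply: le_trans etar1; apply: (le_trans (norm1D _ _)).
    by rewrite norm1Z norm1_dvec mulr1 lerD2l.
  have := min _ lr; have := Hc i u u1; rewrite /g !(innerDl, innerDr, innerZl, innerZr).
  rewrite !inner_dvec (innerC eta (dvec R i)) !inner_dvec !mxE !eqxx /K' /=.
  by lra.
exists eta, s; split => // i.
have s1' : `|s| <= 1 by rewrite gtr0_norm.
have s1'' : `|- s| <= 1 by rewrite normrN.
have := step i s s1'; have := step i (- s) s1''.
have := Hc i s s1'; have := Hc i (- s) s1''.
rewrite !sqrrN; set y := (x - _) 0 i.
have sK2 : s ^+ 2 * K' <= s * dl / 4 by rewrite expr2; nra.
have KK : s ^+ 2 * K <= s ^+ 2 * K' by apply: ler_wpM2l; [exact: sqr_ge0|rewrite /K'; lra].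
by move=> ? ? ? ?; split; lra.
Qed.

Section Tilting.
Context (R : realType) (h : nat) (dT : measure_display) (T : measurableType dT).
Variable P : probability T R.

(** The slope error [3 / 4 * dl] is below the box radius [dl], so each of the [2 * h] tail terms of
    [mgf_tilt] gains [expR (- (b * (s * dl / 4)))]. Under [small] the tails carry at most half of
    [mgf P Z eta], and the box carries the rest. *)
Lemma tilted_lower_bound (Z : T -> 'rV[R]_h) (Phi : 'rV[R]_h -> R) (eta y : 'rV[R]_h)
    (b dl s : R) :
  has_mgf P Z -> (forall l, mgf P Z l = expR (b * Phi l)) -> 0 <= b -> 0 < dl -> 0 < s ->
  (forall i, Phi (eta + s *: dvec R i) <= Phi eta + s * y 0 i + 3 / 4 * (s * dl) /\
             Phi (eta + (- s) *: dvec R i) <= Phi eta - s * y 0 i + 3 / 4 * (s * dl)) ->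
  2 * h%:R * expR (- (b * (s * dl / 4))) <= 1 / 2 ->
  1 / 2 * expR (- (b * (inner eta y + norm1 eta * dl - Phi eta))) <=
    fine (P [set w | forall i, `|Z w 0 i - b * y 0 i| <= b * dl]).
Proof.
move=> HZ mZ b0 dl0 s0 HPhi small.
have := mgf_tilt eta y HZ b0 (ltW dl0) s0.
set p := fine _; rewrite !mZ => H.
have sum_le : \sum_i (expR (- (s * b * (y 0 i + dl))) * mgf P Z (eta + s *: dvec R i) +
            expR (- (s * b * (- y 0 i + dl))) * mgf P Z (eta + (- s) *: dvec R i)) <=
   1 / 2 * expR (b * Phi eta).
  apply: (@le_trans _ _ (\sum_(i < h) (expR (b * Phi eta) * expR (- (b * (s * dl / 4))) *+ 2))).
    apply: ler_sum => i _; have [H1 H2] := HPhi i.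
    rewrite mulr2n !mZ -!expRD; apply: lerD; rewrite ler_expR.
      have := ler_wpM2l b0 H1; lra.
    have := ler_wpM2l b0 H2; lra.
  rewrite sumr_const card_ord -mulrnA -[X in X <= _]mulr_natr natrM.
  have := ler_wpM2l (expR_ge0 (b * Phi eta)) small; lra.
have {sum_le}H : 1 / 2 * expR (b * Phi eta) <= expR (b * (inner eta y + norm1 eta * dl)) * p.
  by move: (le_trans H (lerD (lexx _) sum_le)); lra.
have -> : - (b * (inner eta y + norm1 eta * dl - Phi eta)) =
   b * Phi eta - b * (inner eta y + norm1 eta * dl) by ring.
rewrite expRD expRN mulrA ler_pdivrMr ?expR_gt0//.
by rewrite [X in _ <= X]mulrC.
Qed.

End Tilting.

(** * Lower bound on balls *)

(** Four errors of size [d0 * an]: from [sg] to [z], from [z] to [b * y], from [b] to [an], and from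
    [y] to [x]. *)
Lemma coord_shift_bound (R : realType) (an b sg z x y e dl d0 t Y : R) :
  0 < an -> 0 <= b -> b <= an -> (1 - t) * an <= b -> t * Y <= d0 -> 0 <= t ->
  `|sg - z| <= e * an -> `|z - b * y| <= b * dl -> `|y - x| <= d0 -> `|y| <= Y ->
  0 <= dl -> e <= d0 -> dl <= d0 ->
  `|sg - an * x| <= 4 * (d0 * an).
Proof.
move=> an0 b0 ba tb tY t0 H1 H2 H3 H4 dl0 ed dd.
have -> : sg - an * x = (sg - z) + (z - b * y) + (b - an) * y + an * (y - x) by ring.
have E1 : `|(b - an) * y| <= d0 * an.
  rewrite normrM distrC [`|an - b|]ger0_norm ?subr_ge0//.
  apply: (@le_trans _ _ ((t * an) * Y)); first by apply: ler_pM; rewrite ?subr_ge0//; lra.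
  by rewrite mulrAC; apply: ler_wpM2r => //; exact: ltW.
have E2 : `|an * (y - x)| <= d0 * an.
  by rewrite normrM (gtr0_norm an0) mulrC; apply: ler_wpM2r => //; exact: ltW.
have E3 : e * an <= d0 * an by apply: ler_wpM2r => //; exact: ltW.
have E4 : b * dl <= d0 * an.
  by rewrite mulrC; apply: ler_pM.
apply: (le_trans (ler_normD _ _)); apply: (le_trans (lerD (ler_normD _ _) (lexx _))).
apply: (le_trans (lerD (lerD (ler_normD _ _) (lexx _)) (lexx _))).
lra.
Qed.

Section LowerBound.
Context (R : realType) (h : nat) (dT : measure_display) (T : measurableType dT).
Variables (P : probability T R) (S : nat -> T -> 'rV[R]_h) (a : nat -> R).
Variable phi : 'rV[R]_h -> R.
Hypothesis h0 : (0 < h)%N.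
Hypothesis a_ge1 : forall n, (1 <= n)%N -> 1 <= a n.
Hypothesis a_unbounded : forall A : R, exists N, forall n, (N <= n)%N -> A <= a n.
Hypothesis S_mgf : forall n, (1 <= n)%N -> has_mgf P (S n).
Hypothesis phi_lim : forall l, tends ((lmgf P S a)^~ l) (phi l).
Hypothesis phi_approx : log_mgf_approximable P S a phi.

Let a_gt0 n : (1 <= n)%N -> 0 < a n.
Proof. by move=> n1; apply: lt_le_trans (a_ge1 n1). Qed.

Local Ltac purge := clear - h0 a_ge1 a_unbounded S_mgf phi_lim phi_approx.

Lemma ldp_lower_ball (x : 'rV[R]_h) (V dt gm : R) : 0 < dt -> 0 < gm ->
  (forall l, inner l x - phi l <= V) ->
  exists N, forall n, (N <= n)%N ->
    ((expR (- (a n * (V + gm))))%:E <=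
     P [set w | forall i, (`|S n w 0 i - a n * x 0 i| <= dt * a n)%R])%E.
Proof.
move=> dt0 gm0 HV.
have V0 : 0 <= V by have := HV 0; rewrite inner0l (phi0 phi_lim) subrr.
pose d0 := dt / 4.
have d00 : 0 < d0 by rewrite divr_gt0.
(* Chosen so that [e0 * inner eta eta <= 2 * (V + 1)] gives [|e0 * eta_i| <= d0]: the exposed point
   stays near [x]. *)
pose e0 := d0 ^+ 2 / (2 * (V + 1)).
have V1 : 0 < 2 * (V + 1) by lra.
have e00 : 0 < e0 by rewrite divr_gt0// exprn_gt0.
pose r := 1 + h%:R * (2 * (V + 1) / e0 + 1).
have r1 : 1 <= r.
  by rewrite /r lerDl mulr_ge0// addr_ge0// divr_ge0// ltW.
have r0 : 0 < r by lra.
(* The three bounds serve, in order, the displacement of [S n] from [Z], the error in the value of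
   [phi], and the slack 1/2 required by [exposed_point]. *)
pose e := Num.min d0 (Num.min (gm / (8 * r)) (1 / (2 * r))).
have ep : 0 < e by rewrite !lt_min d00 /= !divr_gt0// mulr_gt0.
have ed : e <= d0 by rewrite ge_min lexx.
have er1 : e * r <= gm / 8.
  rewrite -ler_pdivlMr// -mulrA -invfM; by rewrite !ge_min lexx orbT.
have er2 : e * r <= 1 / 2.
  rewrite -ler_pdivlMr// -mulrA -invfM; by rewrite !ge_min lexx !orbT.
pose dl := Num.min d0 (gm / (8 * r)).
have dlp : 0 < dl by rewrite !lt_min d00 /= !divr_gt0// mulr_gt0.
have dd : dl <= d0 by rewrite ge_min lexx.
have dlr : dl * r <= gm / 8.
  rewrite -ler_pdivlMr// -mulrA -invfM; by rewrite !ge_min lexx orbT.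
have [j [A [j1 A1 HA HZ]]] := phi_approx ep (ltW r0) (ltac:(lra) : 0 < V + gm + 1).
have [K [K0 quad]] := approximant_quadratic h0 S_mgf r j1 A1.
have HA' l : norm1 l <= r -> `|phi l - approximant P S A j l| <= e * r.
  by move=> lr; apply: (le_trans (HA l lr)); apply: ler_wpM2l => //; exact: ltW.
have [] := @exposed_point R h (approximant P S A j) x V K r e0 dl _ e00 dlp K0 V0 (lexx r) _ quad.
- by rewrite /approximant mgf0 ln1 mul0r.
- move=> l lr; have := HV l; have := HA' l lr; rewrite ler_norml => /andP[_].
  by move: er2; purge; lra.
move=> eta [s [etar s0 q step]].
set y := x - e0 *: eta in step.
have yx i : `|y 0 i - x 0 i| <= d0.
  rewrite /y !mxE addrAC subrr add0r normrN normrM (gtr0_norm e00).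
  rewrite -[d0]ger0_norm ?(ltW d00)// -[X in X * _]gtr0_norm// -normrM -ler_sqr ?nnegrE//.
  rewrite !real_normK ?num_real// exprMn.
  have H1 : e0 * eta 0 i ^+ 2 <= 2 * (V + 1).
    by apply: le_trans q; apply: ler_wpM2l; [exact: ltW|exact: coord_sqr_le_inner].
  have -> : d0 ^+ 2 = e0 * (2 * (V + 1)) by rewrite /e0 divfK// gt_eqF.
  by rewrite expr2 -mulrA; apply: ler_wpM2l => //; exact: ltW.
pose Y := norm1 x + d0.
have Y0 : 0 < Y by rewrite ltr_wpDl// norm1_ge0.
have yY i : `|y 0 i| <= Y.
  rewrite -[y 0 i](subrK (x 0 i)) (le_trans (ler_normD _ _))// addrC /Y.
  by apply: lerD => //; exact: le_coord_norm1.
pose t := Num.min (1 / 2) (d0 / Y).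
have t0 : 0 < t by rewrite lt_min divr_gt0//= divr_gt0.
have tY : t * Y <= d0 by rewrite -ler_pdivlMr// ge_min lexx orbT.
have th : t <= 1 / 2 by rewrite ge_min lexx.
have [N1 HN1] := HZ t t0.
have sd : 0 < s * dl / 4 by rewrite divr_gt0// mulr_gt0.
(* Since [b >= a n / 2], this gives [b * (s * dl / 4) >= 4 * h], enough for [small]. The threshold
   [6 / gm] next makes [expR (a n * gm / 2) >= 4]: the tilted probability is then at least twice the
   target, and the exceptional event costs at most one target. *)
have [N2 HN2] := a_unbounded (8 * h%:R / (s * dl / 4)).
have [N3 HN3] := a_unbounded (6 / gm).
exists (maxn 1 (maxn N1 (maxn N2 N3))) => n; rewrite !geq_max => /and4P[n1 nN1 nN2 nN3].
have {HN1} [b [Z [/andP[bn nb] HZn mZ PZ]]] := HN1 n nN1.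
have an0 := a_gt0 n1.
have {HN2} an2 := HN2 n nN2.
have {HN3} an3 := HN3 n nN3.
have bh : a n / 2 <= b.
  by apply: le_trans bn; rewrite mulrC; apply: ler_wpM2r; [exact: ltW|move: th; purge; lra].
have b0 : 0 <= b by apply: le_trans bh; rewrite divr_ge0// ltW.
have small : 2 * h%:R * expR (- (b * (s * dl / 4))) <= 1 / 2.
  have E0 : 4 * h%:R <= b * (s * dl / 4).
    have := ler_wpM2r (ltW sd) bh; move: an2; rewrite ler_pdivrMr//; purge; lra.
  have E1 := expR_ge1Dx (b * (s * dl / 4)).
  rewrite expRN ler_pdivrMr ?expR_gt0//.
  by move: E0 E1; purge; lra.
have tl := tilted_lower_bound HZn mZ b0 dlp s0 step small.
have mG : measurable [set w | forall i, `|Z w 0 i - b * y 0 i| <= b * dl].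
  exact: (measurable_coord_box (fun i => b * y 0 i) (b * dl) HZn.1).
have mS := (S_mgf n1).1.
have mB : measurable [set w | e * a n < norm1 (S n w - Z w)].
  apply: measurable_lt_fun; first exact: measurable_cst.
  by apply: measurable_norm1; apply: measurable_coordsB => //; exact: HZn.1.
have mD := measurable_coord_box (fun i => a n * x 0 i) (dt * a n) mS.
set G := [set w | _] in mG tl. set B := [set w | _] in mB PZ. set D := [set w | _] in mD *.
have GDB : G `<=` D `|` B.
  move=> w Gw; have [Bw|nBw] := pselect (B w); [by right|left] => i.
  have {}nBw : norm1 (S n w - Z w) <= e * a n by rewrite leNgt; apply/negP.
  have -> : dt * a n = 4 * (d0 * a n) by rewrite /d0; field.
  apply: (coord_shift_bound an0 b0 nb bn tY (ltW t0) _ (Gw i) (yx i) (yY i) (ltW dlp) ed dd).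
  by apply: le_trans nBw; have := le_coord_norm1 (S n w - Z w) i; rewrite !mxE.
have PG : (P G <= P D + P B)%E.
  apply: le_trans (measureU2 _ mD mB); apply: le_measure; rewrite ?inE//.
  exact: measurableU.
have fG := fin_num_measure P _ mG; have fD := fin_num_measure P _ mD.
have fB := fin_num_measure P _ mB.
rewrite -(fineK fG) -(fineK fD) -(fineK fB) -EFinD lee_fin in PG.
rewrite -(fineK fB) lee_fin in PZ.
rewrite -(fineK fD) lee_fin.
move: PG PZ tl; move: (fine (P G)) (fine (P D)) (fine (P B)) => pG pD pB PG PZ tl.
have E1 : b * (inner eta y + norm1 eta * dl - approximant P S A j eta) <= a n * (V + gm / 2).
  (* The shift by [- e0 *: eta] can only lower the pairing with [eta], so the cost at [y] is bounded
     by the cost at [x]. *)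
  have F1 : inner eta y <= inner eta x.
    by rewrite /y innerDr innerNr innerZr gerBl; apply: mulr_ge0; [exact: ltW|exact: inner_ge0].
  have F2 := HV eta.
  have F3 : - approximant P S A j eta <= - phi eta + gm / 8.
    by have := HA' eta etar; rewrite ler_norml => /andP[_]; move: er1; purge; lra.
  have F4 : norm1 eta * dl <= gm / 8.
    by apply: le_trans dlr; rewrite mulrC; apply: ler_wpM2l => //; exact: ltW.
  have F5 : inner eta y + norm1 eta * dl - approximant P S A j eta <= V + gm / 2.
    by move: F1 F2 F3 F4 gm0; purge; lra.
  apply: (le_trans (ler_wpM2l b0 F5)); apply: ler_wpM2r => //.
  by rewrite addr_ge0// divr_ge0// ltW.
have E2 : 1 / 2 * expR (- (a n * (V + gm / 2))) <= pG.
  by apply: le_trans tl; rewrite ler_pM2l// ler_expR lerN2.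
have E3 : expR (- (a n * (V + gm / 2))) = expR (- (a n * (V + gm))) * expR (a n * gm / 2).
  by rewrite -expRD; congr expR; field.
have E4 : expR (- (V + gm + 1) * a n) = expR (- (a n * (V + gm))) * expR (- a n).
  by rewrite -expRD; congr expR; ring.
have E5 : 4 <= expR (a n * gm / 2).
  apply: le_trans (expR_ge1Dx _).
  by move: an3; rewrite ler_pdivrMr//; purge; lra.
have E6 : expR (- a n) <= 1 by rewrite -expR0 ler_expR oppr_le0 ltW.
have E7 := expR_gt0 (- (a n * (V + gm))).
rewrite E3 in E2; rewrite E4 in PZ.
have := ler_wpM2l (ltW E7) E5; have := ler_wpM2l (ltW E7) E6.
by move: E2 PZ PG; purge; lra.
Qed.

End LowerBound.

(** * The large deviation principle *)

Section Fenchel.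
Context (R : realType) (h : nat).
Variable phi : 'rV[R]_h -> R.

Lemma fenchel_leP x (c : R) :
  (fenchel phi x <= c%:E)%E <-> forall l, inner l x - phi l <= c.
Proof.
split=> [H l|H]; last by apply: ge_ereal_sup => _ [l _ <-]; rewrite lee_fin.
rewrite -lee_fin; apply: le_trans H.
by apply: ereal_sup_ubound; exists l.
Qed.

Lemma lt_fenchelP x (c : R) : (c%:E < fenchel phi x)%E -> exists l, c < inner l x - phi l.
Proof. by move=> /ereal_sup_gt [_ [l _ <-]]; rewrite lte_fin => ?; exists l. Qed.

Lemma fenchel_ge x l : ((inner l x - phi l)%:E <= fenchel phi x)%E.
Proof. by apply: ereal_sup_ubound; exists l. Qed.

Lemma box_compact (r : R) : compact [set x : 'rV[R]_h | forall i, `|x 0 i| <= r].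
Proof.
have -> : [set x : 'rV[R]_h | forall i, `|x 0 i| <= r] =
    [set v | forall i, `[- r, r]%classic (v ord0 i)].
  by apply/seteqP; split => x H i; have := H i; rewrite /= in_itv/= ler_norml.
by apply: (@rV_compact R h (fun=> `[- r, r]%classic)) => i; exact: segment_compact.
Qed.

Lemma fenchel_level_closed (c : R) : closed [set x | (fenchel phi x <= c%:E)%E].
Proof.
have -> : [set x | (fenchel phi x <= c%:E)%E] =
    \bigcap_l (inner l @^-1` [set z | z <= c + phi l]).
  apply/seteqP; split => x /=.
    by move=> /fenchel_leP H l _ /=; rewrite -lerBlDr.
  by move=> H; apply/fenchel_leP => l; rewrite lerBlDr; exact: (H l I).
apply: closed_bigI => l _; apply: closed_comp; last exact: closed_le.
by move=> x _; exact: inner_continuous.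
Qed.

Definition coord_bound : R := \sum_i (`|phi (dvec R i)| + `|phi (- dvec R i)|).

(** Finiteness of [phi] at the [2 * h] signed basis vectors makes [phi^*] exceed [c] outside a box;
    this gives compact level sets and disposes of the unbounded part of a closed set. *)
Lemma outside_box (x : 'rV[R]_h) (c : R) i : c + coord_bound < `|x 0 i| ->
  exists2 l, l = dvec R i \/ l = - dvec R i & c + phi l < inner l x.
Proof.
have [H1 H2] : phi (dvec R i) <= coord_bound /\ phi (- dvec R i) <= coord_bound.
  have : `|phi (dvec R i)| + `|phi (- dvec R i)| <= coord_bound.
    by rewrite /coord_bound (bigD1 i)//= lerDl; apply: sumr_ge0 => k _; rewrite addr_ge0.
  have := ler_norm (phi (dvec R i)); have := ler_norm (phi (- dvec R i)).
  have := normr_ge0 (phi (dvec R i)); have := normr_ge0 (phi (- dvec R i)).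
  by move=> ? ? ? ? ?; split; lra.
have [x0|x0] := leP 0 (x 0 i) => H.
  exists (dvec R i); [by left|rewrite inner_dvec].
  by move: H; rewrite ger0_norm//; lra.
exists (- dvec R i); [by right|rewrite innerNl inner_dvec].
by move: H; rewrite ltr0_norm//; lra.
Qed.

Lemma fenchel_level_compact (c : R) : compact [set x | (fenchel phi x <= c%:E)%E].
Proof.
apply: subclosed_compact (@box_compact (c + coord_bound)) _; first exact: fenchel_level_closed.
move=> x /= /fenchel_leP H i; rewrite leNgt; apply/negP => /outside_box [l _].
by have := H l; lra.
Qed.

(** Inside the box compactness extracts finitely many half-spaces; outside it the signed basis
    vectors suffice. The latter play the part of exponential tightness. *)
Lemma halfspace_cover (F : set 'rV[R]_h) (c : R) : closed F ->
  (forall x, F x -> (c%:E < fenchel phi x)%E) ->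
  exists L : seq 'rV[R]_h, forall x, F x -> exists2 l, l \in L & c + phi l <= inner l x.
Proof.
move=> cF HF.
pose Bx := [set x : 'rV[R]_h | forall i, `|x 0 i| <= c + coord_bound].
have : compact (Bx `&` F) by apply: compact_closedI => //; exact: box_compact.
rewrite compact_cover => /(_ 'rV[R]_h setT (fun l => inner l @^-1` [set z | c + phi l < z])).
case.
- move=> l _; move/continuousP : (@inner_continuous R h l); apply; exact: open_gt.
- by move=> x [_ /HF /lt_fenchelP [l Hl]]; exists l => //=; rewrite -ltrBrDr.
move=> D _ HD.
exists ([seq dvec R i | i <- enum 'I_h] ++ [seq - dvec R i | i <- enum 'I_h] ++ finmap.enum_fset D).
move=> x Fx.
have [xB|/existsNP [i /negP]] := pselect (Bx x).
  have [l /= lD Hl] := HD x (conj xB Fx).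
  by exists l; [rewrite !mem_cat lD !orbT|exact: ltW].
rewrite -ltNge => /outside_box [l Hl lx]; exists l; last exact: ltW.
by case: Hl => ->; rewrite !mem_cat; apply/orP; [left|right; apply/orP; left];
  apply: map_f; rewrite mem_enum.
Qed.

Hypothesis phi0 : phi 0 = 0.

Lemma fenchel_ge0 x : (0 <= fenchel phi x)%E.
Proof. by apply: le_trans (fenchel_ge x 0); rewrite inner0l phi0 subrr. Qed.

Lemma fenchel_good : good_rate_function (fenchel phi).
Proof.
split; [split; [exact: fenchel_ge0|exact: fenchel_level_closed]|exact: fenchel_level_compact].
Qed.

Lemma fenchel_convex : convex_efun (fenchel phi).
Proof.
move=> x y t /andP[t0 t1]; apply: ge_ereal_sup => _ [l _ <-].
have -> : inner l (t *: x + (1 - t) *: y) - phi l =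
    t * (inner l x - phi l) + (1 - t) * (inner l y - phi l).
  by rewrite innerDr !innerZr; ring.
rewrite EFinD !EFinM; apply: leeD; apply: lee_wpmul2l; rewrite ?lee_fin ?subr_ge0//;
  exact: fenchel_ge.
Qed.

Lemma fenchel_eq0 x : fenchel phi x = 0%E <-> forall l, inner l x <= phi l.
Proof.
split=> [H l|H].
  by have /fenchel_leP/(_ l) : (fenchel phi x <= 0%:E)%E by [rewrite H]; rewrite subr_le0.
apply/eqP; rewrite eq_le fenchel_ge0 andbT.
by apply/fenchel_leP => l; rewrite subr_le0.
Qed.

End Fenchel.

Section LimSup.
Variable R : realType.

Lemma limn_esup_le (u : nat -> \bar R) (c : \bar R) N :
  (forall n, (N <= n)%N -> (u n <= c)%E) -> (limn_esup u <= c)%E.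
Proof.
move=> H; rewrite /limn_esup /limf_esup.
apply: (@le_trans _ _ (ereal_sup (u @` [set n | (N <= n)%N]))).
  by apply: ereal_inf_lbound; exists [set n | (N <= n)%N] => //; exists N.
by apply: ge_ereal_sup => _ [n /= Nn <-]; exact: H.
Qed.

Lemma cvg_EFin_tends (u : nat -> R) (p : R) (f : nat -> \bar R) : tends u p ->
  (forall n, (1 <= n)%N -> f n = (u n)%:E) -> f @ \oo --> p%:E.
Proof.
move=> up fu.
have : (EFin \o u) @ \oo --> p%:E by apply: cvg_EFin; [exact: nearW|exact: cvg_tends].
apply: cvg_trans; apply: near_eq_cvg.
by exists 1%N => // n /= n1; rewrite fu.
Qed.

Lemma lne_le_rate (a c : R) (p : \bar R) : 0 < a -> (0 <= p)%E ->
  (p <= (expR (- (a * c)))%:E)%E -> (a^-1%:E * lne p <= (- c)%:E)%E.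
Proof.
move=> a0 p0 H.
have L : (lne p <= (- (a * c))%:E)%E.
  rewrite -[X in (_ <= X%:E)%E]expRK -lne_EFin ?expR_gt0//.
  by rewrite lee_lne ?in_itv/= ?leey ?andbT// lee_fin expR_ge0.
apply: (le_trans (lee_wpmul2l _ L)); first by rewrite lee_fin invr_ge0 ltW.
by rewrite -EFinM lee_fin mulrN mulrA mulVf ?mul1r// gt_eqF.
Qed.

Lemma lne_ge_rate (a c : R) (p : \bar R) : 0 < a ->
  ((expR (- (a * c)))%:E <= p)%E -> ((- c)%:E <= a^-1%:E * lne p)%E.
Proof.
move=> a0 H.
have L : ((- (a * c))%:E <= lne p)%E.
  rewrite -[X in (X%:E <= _)%E]expRK -lne_EFin ?expR_gt0//.
  have p0 : (0 <= p)%E by apply: le_trans H; rewrite lee_fin expR_ge0.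
  by rewrite lee_lne ?in_itv/= ?leey ?andbT// lee_fin expR_ge0.
have := lee_wpmul2l (_ : (0 <= a^-1%:E)%E) L; rewrite lee_fin invr_ge0 (ltW a0) => /(_ isT).
by rewrite -EFinM mulrN mulrA mulVf ?mul1r// gt_eqF.
Qed.

End LimSup.

Lemma interior_box (R : realType) (h : nat) (G : set 'rV[R]_h) (x : 'rV[R]_h) : interior G x ->
  exists2 e : R, 0 < e & forall z : 'rV[R]_h, (forall i, `|z 0 i - x 0 i| <= e) -> G z.
Proof.
move=> /nbhs_ballP [e /= e0 He]; exists (e / 2); first by rewrite divr_gt0.
move=> z Hz; apply: He; split => // i j; rewrite ord1 /ball/= distrC.
by apply: (le_lt_trans (Hz j)); rewrite ltr_pdivrMr//; lra.
Qed.

(** * Upper and lower bounds for Borel sets *)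

Section LargeDeviations.
Context (R : realType) (h : nat) (dT : measure_display) (T : measurableType dT).
Variables (P : probability T R) (S : nat -> T -> 'rV[R]_h) (a : nat -> R).
Variable phi : 'rV[R]_h -> R.
Hypothesis h0 : (0 < h)%N.
Hypothesis a_ge1 : forall n, (1 <= n)%N -> 1 <= a n.
Hypothesis a_unbounded : forall A : R, exists N, forall n, (N <= n)%N -> A <= a n.
Hypothesis rS : forall n, rvec (S n).
Hypothesis S_mgf : forall n, (1 <= n)%N -> has_mgf P (S n).
Hypothesis phi_lim : forall l, tends ((lmgf P S a)^~ l) (phi l).
Hypothesis phi_approx : log_mgf_approximable P S a phi.

Local Ltac purge := clear - h0 a_ge1 a_unbounded rS S_mgf phi_lim phi_approx.

Let a_gt0 n : (1 <= n)%N -> 0 < a n.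
Proof. by move=> n1; apply: lt_le_trans (a_ge1 n1). Qed.

Let Y n w := (a n)^-1 *: S n w.

Let Y_measurable n G : borelRV G -> measurable (Y n @^-1` G).
Proof. by move=> bG; exact: rvecZ (rS n) _ bG. Qed.

Lemma lmgf_uniform (L : seq 'rV[R]_h) (e : R) : 0 < e -> exists N, forall n, (N <= n)%N ->
  forall l, l \in L -> lmgf P S a n l <= phi l + e.
Proof.
move=> e0; elim: L => [|l L [N IH]]; first by exists 0%N.
have [M HM] := phi_lim l e0.
exists (maxn M N) => n; rewrite geq_max => /andP[nM nN] k.
rewrite in_cons => /predU1P[->|]; last exact: IH.
by have := HM n nM; rewrite ler_norml => /andP[_]; purge; lra.
Qed.

(** Half of [gm] covers the convergence of the log-mgfs at the finitely many slopes, half the number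
    of half-spaces. The set [G] is kept apart from [F], which will be its closure. *)
Lemma ldp_upper_prob (F : set 'rV[R]_h) (c gm : R) : closed F -> 0 < gm ->
  (forall x, F x -> (c%:E < fenchel phi x)%E) ->
  exists N, forall n, (N <= n)%N -> forall G, borelRV G -> G `<=` F ->
    (P (Y n @^-1` G) <= (expR (- (a n * (c - gm))))%:E)%E.
Proof.
move=> cF gm0 HF.
have [L HL] := halfspace_cover cF HF.
have g2 : 0 < gm / 2 by rewrite divr_gt0.
have [N1 HN1] := lmgf_uniform L g2.
have [N2 HN2] := a_unbounded (2 * (size L)%:R / gm).
exists (maxn 1 (maxn N1 N2)) => n; rewrite !geq_max => /and3P[n1 nN1 nN2] G bG GF.
have {}HN1 := HN1 n nN1; have {}HN2 := HN2 n nN2.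
have an0 := a_gt0 n1; have HX := S_mgf n1.
pose H l := [set w | a n * (c + phi l) <= inner l (S n w)].
have mH l : measurable (H l).
  by apply: measurable_le_fun; [exact: measurable_cst|exact: measurable_inner HX.1].
have PH l : l \in L -> (P (H l) <= (expR (- (a n * (c - gm / 2))))%:E)%E.
  move=> lL.
  have Hc : (P (H l) <= (expR (- (a n * (c + phi l))) * mgf P (S n) l)%:E)%E by exact: mgf_chernoff.
  apply: (le_trans Hc).
  rewrite lee_fin -[mgf _ _ _]lnK ?posrE ?mgf_gt0// -expRD ler_expR.
  have := HN1 l lL; rewrite /lmgf ler_pdivrMr//; purge; lra.
have sub : Y n @^-1` G `<=` \big[setU/set0]_(l <- L) H l.
  move=> w /GF /HL [l lL Hl]; rewrite -bigcup_seq; exists l => //=.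
  move: Hl; rewrite /Y innerZr -(ler_pM2l an0) mulrA mulfV ?mul1r// gt_eqF//.
have mU : measurable (\big[setU/set0]_(l <- L) H l).
  by apply: bigsetU_measurable => l _; exact: mH.
apply: (@le_trans _ _ (P (\big[setU/set0]_(l <- L) H l))).
  by apply: le_measure; rewrite ?inE//; exact: Y_measurable.
have {mU sub} : (P (\big[setU/set0]_(l <- L) H l) <=
    ((size L)%:R * expR (- (a n * (c - gm / 2))))%:E)%E.
  elim: (L) PH => [|l L' IH] PH; first by rewrite big_nil measure0 mul0r.
  rewrite big_cons; apply: (le_trans (measureU2 _ (mH l) _)).
    by apply: bigsetU_measurable => k _; exact: mH.
  rewrite /= -natr1 mulrDl mul1r (addrC (_%:R * _)) EFinD; apply: leeD.
    by apply: PH; rewrite mem_head.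
  by apply: IH => k kL; apply: PH; rewrite in_cons kL orbT.
move=> /le_trans; apply; rewrite lee_fin.
have -> : - (a n * (c - gm)) = a n * gm / 2 + - (a n * (c - gm / 2)) by field.
rewrite expRD; apply: ler_wpM2r; first exact: expR_ge0.
apply: le_trans (expR_ge1Dx _).
by move: HN2; rewrite ler_pdivrMr//; purge; lra.
Qed.

Lemma ldp : LDP P Y a (fenchel phi).
Proof.
have p0 := phi0 phi_lim.
move=> G bG; split.
  rewrite /limn_einf leeN2.
  apply: le_ereal_inf_tmp => _ [x Gx <-].
  have [e e0 He] := interior_box Gx.
  case Ex : (fenchel phi x) => [V||]; last 2 first.
  - exact: leey.
  - by have := fenchel_ge0 p0 x; rewrite Ex.
  apply/lee_addgt0Pr => g g0.
  have HV : forall l, inner l x - phi l <= V by apply/fenchel_leP; rewrite Ex.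
  have [N HN] := ldp_lower_ball h0 a_ge1 a_unbounded S_mgf phi_lim phi_approx e0 g0 HV.
  apply: (@limn_esup_le _ _ _ (maxn 1 N)) => n; rewrite geq_max => /andP[n1 nN].
  have an0 := a_gt0 n1.
  rewrite -EFinD -[X in (_ <= X)%E]oppeK leeN2 -EFinN.
  apply: lne_ge_rate => //; apply: (le_trans (HN n nN)).
  apply: le_measure; rewrite ?inE.
  - exact: (measurable_coord_box (fun i => a n * x 0 i) (e * a n) (rvec_coords (rS n))).
  - exact: Y_measurable.
  move=> w /= Hw; apply: He => i; have := Hw i.
  rewrite !mxE -(ler_pM2r (x := `|(a n)^-1|)) ?normr_gt0 ?invr_neq0 ?gt_eqF//.
  rewrite -normrM mulrBl mulrAC mulfV ?gt_eqF// mul1r mulrC.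
  by rewrite (gtr0_norm (_ : 0 < (a n)^-1)) ?invr_gt0// mulfK// gt_eqF.
set J := ereal_inf _.
have J0 : (0 <= J)%E by apply: le_ereal_inf_tmp => _ [x _ <-]; exact: fenchel_ge0.
(* Stated for every real [c] below the infimum, so that a finite and an infinite infimum are treated
   alike. *)
have key (c : R) : (c%:E < J)%E -> (limn_esup (fun n => (a n)^-1%:E * lne (P (Y n @^-1` G))) <= (- c)%:E)%E.
  move=> cJ; apply/lee_addgt0Pr => g g0.
  have HF x : closure G x -> (c%:E < fenchel phi x)%E.
    by move=> Gx; apply: (lt_le_trans cJ); apply: ereal_inf_lbound; exists x.
  have [N HN] := ldp_upper_prob (@closed_closure _ G) g0 HF.
  apply: (@limn_esup_le _ _ _ (maxn 1 N)) => n; rewrite geq_max => /andP[n1 nN].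
  rewrite -EFinD (_ : - c + g = - (c - g)); last by ring.
  apply: lne_le_rate; [exact: a_gt0|exact: measure_ge0|].
  by apply: HN => //; exact: subset_closure.
case: J J0 key => [j||] J0 key //.
  apply/lee_addgt0Pr => g g0; rewrite -EFinN -EFinD (_ : - j + g = - (j - g)); last by ring.
  by apply: key; rewrite lte_fin gtrBl.
rewrite leeNy_eq; apply/eqP/eq_ninfty => t.
by rewrite -[t]opprK; apply: key; exact: ltry.
Qed.

End LargeDeviations.

Theorem mainTheorem5 (R : realType) (d h : nat) (dT : measure_display)
    (T : measurableType dT) (P : probability T R) (S : nat -> T -> 'rV[R]_h) :
  (0 < d)%N -> (0 < h)%N ->
  (forall n, rvec (S n)) ->
  exp_regular P d S ->
  exp_nearly_additive P d S ->
  (forall l : 'rV[R]_h, exists M : R, forall n : nat, (1 <= n)%N ->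
     ((Lam R d n)^-1%:E * logmgf P (S n) l <= M%:E)%E) ->
  exists (Shat : 'rV[R]_h) (phi : 'rV[R]_h -> R),
    [/\ forall i : 'I_h,
          (fun n => (Lam R d n)^-1%:E * expect_coord P (S n) i)%E @ \oo
            --> (Shat 0 i)%:E,
        forall l : 'rV[R]_h,
          (fun n => (Lam R d n)^-1%:E * logmgf P (S n) l)%E @ \oo --> (phi l)%:E,
        LDP P (fun n w => (Lam R d n)^-1 *: S n w) (Lam R d) (fenchel phi),
        good_rate_function (fenchel phi) /\ convex_efun (fenchel phi)
      & forall x : 'rV[R]_h, fenchel phi x = 0%E <-> x = Shat].
Proof.
move=> d0 h0 rS regS addS HM.
have a1 n (n1 : (1 <= n)%N) := @Lam_ge1 R d n n1.
have a0 n (n1 : (1 <= n)%N) := @Lam_gt0 R d n n1.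
have HS n : (1 <= n)%N -> has_mgf P (S n).
  move=> n1; split; first exact: rvec_coords.
  move=> l; apply: intble_ge0.
  - by apply: measurableT_comp => //; exact: rvec_inner.
  - by move=> w; exact: expR_ge0.
  (* The bound on the normalized logarithm excludes an infinite moment generating function. *)
  - rewrite ltey; apply/eqP => Hoo; have [M /(_ n n1)] := HM l.
    by rewrite /logmgf Hoo /= gt0_muley ?lte_fin ?invr_gt0 ?a0.
have logmgfE n l : (1 <= n)%N -> logmgf P (S n) l = (ln (mgf P (S n) l))%:E.
  by move=> n1; rewrite /logmgf -EFin_mgf ?lne_EFin ?mgf_gt0//; exact: HS.
have bound l : exists M : R, forall n, (1 <= n)%N -> ln (mgf P (S n) l) <= M * Lam R d n.
  have [M H] := HM l; exists M => n n1; have := H n n1.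
  by rewrite logmgfE// -EFinM lee_fin mulrC ler_pdivrMr// a0.
have unb := @Lam_unbounded R d d0.
have appr := nearly_additive_iid_approximable d0 h0 rS HS regS addS.
have [phi [phi_lim phi_appr]] := log_mgf_limit h0 a1 unb HS bound appr.
have p0 := phi0 phi_lim.
have [Shat [mean_lim HShat]] := mean_limit h0 a1 HS phi_lim phi_appr.
exists Shat, phi; split.
(* The identification starts at [n = 1]: the volume vanishes at [n = 0]. *)
- move=> i; apply: cvg_EFin_tends (mean_lim i) _ => n n1.
  rewrite /expect_coord -EFin_Ex; last by apply: intble_coord; exact: HS.
  by rewrite -EFinM /nmean mxE mulrC.
- move=> l; apply: cvg_EFin_tends (phi_lim l) _ => n n1.
  by rewrite logmgfE// -EFinM mulrC.
- exact: (ldp h0 a1 unb rS HS phi_lim phi_appr).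
- by split; [exact: fenchel_good|exact: fenchel_convex].
- by move=> x; rewrite fenchel_eq0// HShat.
Qed.
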